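(* Let $a<b$ be real numbers, let $n\ge1$ be an odd integer, and let $f:[a,b]\to\mathbb{R}$ be a function such that $f^{(n-1)}$ is absolutely continuous on $[a,b]$ and $f^{(n)}\in L^2[a,b]$. Then for all $\theta\in[0,1]$, $$|I-F_n|\le\frac{(b-a)^{n+\frac12}}{n!\,2^n}\sqrt{\frac{\theta^2n^2(2n+1)-\theta(4n^2-1)+(2n-1)}{(2n+1)(2n-1)}}\,\sqrt{\sigma(f^{(n)})}.$$ This inequality is sharp in the sense that the constant $\frac{1}{n!\,2^n}\sqrt{\frac{\theta^2n^2(2n+1)-\theta(4n^2-1)+(2n-1)}{(2n+1)(2n-1)}}$ cannot be replaced by a smaller one; that is, if $C>0$ is such that $|I-F_n|\le C(b-a)^{n+\frac12}\sqrt{\sigma(f^{(n)})}$ for all such functions $f$, then $C\ge\frac{1}{n!\,2^n}\sqrt{\frac{\theta^2n^2(2n+1)-\theta(4n^2-1)+(2n-1)}{(2n+1)(2n-1)}}$.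
   Context: Notation: $I=\int_a^b f(x)\,dx$, and, for the parameter $\theta\in[0,1]$, $$F_n=(b-a)\left[(1-\theta)f\left(\tfrac{a+b}{2}\right)+\theta\,\tfrac{f(a)+f(b)}{2}\right]+\sum_{i=1}^{\lfloor (n-1)/2\rfloor}\frac{[1-\theta(2i+1)](b-a)^{2i+1}}{(2i+1)!\,2^{2i}}\,f^{(2i)}\left(\tfrac{a+b}{2}\right),$$ where $\lfloor\cdot\rfloor$ is the integer part and an empty sum is $0$. For $g\in L^2[a,b]$, $\sigma(g)=\|g\|_2^2-\frac1{b-a}\left(\int_a^b g(x)\,dx\right)^2$, where $\|g\|_2=\left(\int_a^b|g(x)|^2dx\right)^{1/2}$. $f^{(0)}=f$, and $f^{(n)}$ is defined almost everywhere. *)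

(* Defs.v *)
From HB Require Import structures.
From mathcomp Require Import all_boot all_order all_algebra.
From mathcomp Require Import all_classical all_reals all_analysis.

Set Implicit Arguments.
Unset Strict Implicit.
Unset Printing Implicit Defensive.

Import Order.TTheory GRing.Theory Num.Theory.
Import numFieldNormedType.Exports.

Local Open Scope classical_set_scope.
Local Open Scope ring_scope.

(* A function on [a, b] is represented by a total function R -> R; every notion
   below depends only on its values on [a, b]. *)

(* Derivative relative to A: with A = [a, b] it is the usual derivative inside
   and the one-sided derivative at a and b.  [derive1_in A f x] has a junk value
   when the limit does not exist, so that an almost-everywhere derivative is a
   total function. *)
Definition derivable_in (R : realType) (A : set R) (f : R -> R) (x : R) : Prop :=
  cvg ((f y - f x) / (y - x) @[y --> within A x^']).

Definition derive1_in (R : realType) (A : set R) (f : R -> R) (x : R) : R :=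
  lim ((f y - f x) / (y - x) @[y --> within A x^']).

Definition derive1n_in (R : realType) (A : set R) (k : nat) (f : R -> R) : R -> R :=
  iter k (derive1_in A) f.

Definition abs_continuous_on (R : realType) (a b : R) (f : R -> R) : Prop :=
  forall e : R, 0 < e -> exists2 d : R, 0 < d &
    forall (m : nat) (u v : 'I_m -> R),
      (forall i, a <= u i /\ u i <= v i /\ v i <= b) ->
      trivIset [set: 'I_m] (fun i => `]u i, v i[%classic) ->
      \sum_(i < m) (v i - u i) < d ->
      \sum_(i < m) `|f (v i) - f (u i)| < e.

(* Extension by zero turns a function on [a, b] into one on the whole line, the
   domain on which [Lfun] and [Lnorm] are defined. *)
Definition L2_on (R : realType) (a b : R) (g : R -> R) : Prop :=
  (g \_ `[a, b]%classic) \in Lfun (@lebesgue_measure R) 2%:E.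

Definition L2norm_on (R : realType) (a b : R) (g : R -> R) : R :=
  fine ('N[@lebesgue_measure R]_2%:E[EFin \o (g \_ `[a, b]%classic)]).

Definition sigma (R : realType) (a b : R) (g : R -> R) : R :=
  L2norm_on a b g ^+ 2 -
  (b - a)^-1 * (\int[@lebesgue_measure R]_(x in `[a, b]) g x) ^+ 2.

(* f^(n-1) exists everywhere on [a, b] and is absolutely continuous there, and
   f^(n) (which then exists almost everywhere) is in L^2[a, b]. *)
Definition admissible (R : realType) (a b : R) (n : nat) (f : R -> R) : Prop :=
  [/\ forall k : nat, (k < n - 1)%N -> forall x : R, x \in `[a, b] ->
        derivable_in `[a, b]%classic (derive1n_in `[a, b]%classic k f) x,
      abs_continuous_on a b (derive1n_in `[a, b]%classic (n - 1) f) &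
      L2_on a b (derive1n_in `[a, b]%classic n f)].

Definition quad (R : realType) (a b : R) (n : nat) (theta : R) (f : R -> R) : R :=
  (b - a) * ((1 - theta) * f ((a + b) / 2) + theta * ((f a + f b) / 2)) +
  \sum_(1 <= i < ((n - 1) %/ 2).+1)
     (1 - theta * (2 * i + 1)%:R) * (b - a) ^+ (2 * i + 1) /
     ((2 * i + 1)`!%:R * 2 ^+ (2 * i)) *
     derive1n_in `[a, b]%classic (2 * i) f ((a + b) / 2).

(* Main.v *)
(** Write [h = (b - a) / 2], [m = (a + b) / 2], and let [K] be the Appell-type kernel equal to
    [((x - a)^n - theta h n (x - a)^(n-1)) / n!] on [[a, m]] and to
    [((x - b)^n + theta h n (x - b)^(n-1)) / n!] on [[m, b]].  Integrating by parts [n] times on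
    each half gives [I - F_n = - int K f^(n)]: the jumps of the derivatives of [K] at [m] produce
    the even-order terms of [F_n].  Since [n] is odd, [K] is odd about [m], so [int K = 0] and
    [f^(n)] may be replaced by [f^(n)] minus its mean; Cauchy-Schwarz then bounds the error by
    [||K||_2 sqrt(sigma(f^(n)))], and [||K||_2] is the stated constant.  Equality holds when
    [f^(n) = K], which a function glued from two polynomials at [m] achieves.

    The only non-elementary input is the fundamental theorem of calculus for an absolutely
    continuous [F]: [F] is a difference of two nondecreasing absolutely continuous functions
    (total variation), the Stieltjes measure of each is dominated by Lebesgue measure, and the
    Radon-Nikodym density is the a.e. derivative by Lebesgue's differentiation theorem. *)

Require Import Defs.
From HB Require Import structures.
From mathcomp Require Import all_boot all_order all_algebra.
From mathcomp Require Import all_classical all_reals all_analysis.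
From mathcomp Require Import measurable_realfun zify ring lra.

Set Implicit Arguments.
Unset Strict Implicit.
Unset Printing Implicit Defensive.

Import Order.TTheory GRing.Theory Num.Theory.
Import numFieldNormedType.Exports.

Local Open Scope classical_set_scope.
Local Open Scope ring_scope.

(** * Stieltjes measures of absolutely continuous functions *)

(** Finite measure rules out infinite endpoints, and openness identifies [A] with its interior,
    which removes closed ends. The empty set is the degenerate []0, 0[]. The lemma will be applied
    to the components of an open set. *)
Lemma open_interval_finite_measure (R : realType) (A : set R) :
  open A -> is_interval A -> (@lebesgue_measure R A < +oo)%E ->
  exists x y, x <= y /\ A = `]x, y[%classic.
Proof.
move=> oA /is_intervalP; case: (Rhull A) => l r AE Aoo.
have [->|/set0P[z Az]] := eqVneq A set0.
  by exists 0, 0; split => //; rewrite set_itvoo0.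
have zlr : z \in Interval l r by move: Az; rewrite AE.
move: Aoo; rewrite AE lebesgue_measure_itv.
case: l AE zlr => [bl x|[]]; case: r => [br y|[]] //= AE zlr;
  rewrite ?ltNyr ?ltry ?ltNyy //= => _.
- have AE' : A = `]x, y[%classic.
    by rewrite -(interior_itv_bnd x y bl br) -AE; apply/esym/interior_id.
  exists x, y; rewrite -AE AE'; split=> //; move: Az.
  by rewrite AE' /= in_itv/= => /andP[xz /(lt_trans xz)/ltW].
- by move: zlr; rewrite in_itv/= andbF.
Qed.

Lemma lebesgue_stieltjes_measure_itvoc (R : realType) (G : cumulative R R) (x y : R) :
  x <= y -> lebesgue_stieltjes_measure G `]x, y]%classic = (G y - G x)%:E.
Proof.
move=> xy; rewrite /lebesgue_stieltjes_measure/= /measure_extension/=.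
by rewrite measurable_mu_extE//= ?wlength_itv_bnd//; exact: is_ocitv.
Qed.

(** By outer regularity a Lebesgue-null set lies in an open [U] of measure less than [d]. The
    countably many disjoint components of [U] have total length less than [d], so every finite
    subfamily has total increment less than [e], and so the Stieltjes measure of [U] is at most
    [e]. *)
Lemma stieltjes_dominated (R : realType) (G : cumulative R R) :
  (forall e : R, 0 < e -> exists2 d : R, 0 < d &
    forall (m : nat) (u v : 'I_m -> R),
      (forall i, u i <= v i) ->
      trivIset [set: 'I_m] (fun i => `]u i, v i[%classic) ->
      \sum_(i < m) (v i - u i) < d ->
      \sum_(i < m) (G (v i) - G (u i)) < e) ->
  lebesgue_stieltjes_measure G `<< @lebesgue_measure R.
Proof.
move=> ac; apply/null_content_dominatesP => A mA A0.
have stE := @lebesgue_stieltjes_measure_itvoc R G.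
apply/eqP; rewrite eq_le measure_ge0 andbT.
apply/lee_addgt0Pr => e e0; rewrite add0e.
have [d d0 acd] := ac e e0.
have [|U [oU AU Ud]] := lebesgue_regularity_outer mA _ d0; first by rewrite A0.
have mU : measurable U by exact: open_measurable.
have {}Ud : (@lebesgue_measure R U < d%:E)%E.
  rewrite -(setDUK AU); apply: le_lt_trans Ud.
  apply: (@le_trans _ _ (lebesgue_measure A + lebesgue_measure (U `\` A))%E).
    by apply: measureU2 => //; exact: measurableD.
  by rewrite A0 add0e.
apply: (@le_trans _ _ (lebesgue_stieltjes_measure G U)).
  by apply: le_measure => //; rewrite inE.
have mI i : measurable (open_disjoint_itv oU i).
  by apply: open_measurable; exact: open_disjoint_itv_open.
have UE (mu : {measure set (measurableTypeR R) -> \bar R}) :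
    mu U = (\sum_(0 <= i <oo | i \in [set: nat]) mu (open_disjoint_itv oU i))%E.
  rewrite [X in mu X](open_disjoint_itv_bigcup oU); apply: measure_bigcup => [i _|].
    exact: mI.
  exact: open_disjoint_itv_trivIset.
rewrite UE.
have IU i : open_disjoint_itv oU i `<=` U.
  by rewrite [X in _ `<=` X](open_disjoint_itv_bigcup oU); exact: bigcup_sup.
have /choice[x] : forall i, exists xy : R * R,
    xy.1 <= xy.2 /\ open_disjoint_itv oU i = `]xy.1, xy.2[%classic.
  move=> i.
  have [|||x [y [xy Ei]]] := @open_interval_finite_measure R (open_disjoint_itv oU i).
  - exact: open_disjoint_itv_open.
  - exact: open_disjoint_itv_is_interval.
  - apply: (@le_lt_trans _ _ (lebesgue_measure U)); last exact: lt_trans Ud (ltry _).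
    by apply: le_measure; [rewrite inE; exact: mI|rewrite inE|exact: IU].
  - by exists (x, y).
move=> /all_and2[xle xE].
apply: lime_le; first by apply: is_cvg_nneseries.
apply: nearW => m.
rewrite big_mkord.
under eq_bigl do rewrite in_setT.
rewrite ?big_mkord/=.
(* The component is enlarged to []x, y]], whose Stieltjes measure is exactly the increment of
   [G]. *)
apply: (@le_trans _ _ (\sum_(i < m) (G (x i).2 - G (x i).1)%:E)%E).
  apply: lee_sum => i _; rewrite -stE//.
  apply: le_measure; [rewrite inE; exact: mI|rewrite inE; exact: measurable_itv|].
  by rewrite xE => z; exact: subset_itv_oo_oc.
rewrite sumEFin lee_fin; apply/ltW/acd => //.
  have := @open_disjoint_itv_trivIset _ _ oU.
  move=> /trivIsetP h; apply/trivIsetP => i j _ _ ij; rewrite -!xE.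
  exact: h.
rewrite -lte_fin; apply: le_lt_trans Ud.
rewrite UE.
rewrite -sumEFin (eq_bigr (fun i : 'I_m => lebesgue_measure (open_disjoint_itv oU i))).
  have := @nneseries_lim_ge R (fun i => lebesgue_measure (open_disjoint_itv oU i))
    (fun i => i \in [set: nat]) 0%N m.
  rewrite big_mkord => /(_ (fun n _ _ => measure_ge0 _ _)); apply: le_trans.
  by rewrite le_eqVlt; apply/predU1P; left; apply: eq_bigl => i; rewrite in_setT.
move=> i _; rewrite xE lebesgue_measure_itv/= lte_fin.
by have [||->] := ltgtP (x i).1 (x i).2; rewrite ?subrr// ltNge xle.
Qed.

(** Arbitrary finite index types are convenient because the cells of several partitions are indexed
    by dependent pairs. *)
Lemma abs_continuous_on_fin (R : realType) (a b : R) (F : R -> R) (e : R) :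
  abs_continuous_on a b F -> 0 < e -> exists2 d : R, 0 < d &
    forall (I : finType) (u v : I -> R),
      (forall i, a <= u i /\ u i <= v i /\ v i <= b) ->
      trivIset [set: I] (fun i => `]u i, v i[%classic) ->
      \sum_i (v i - u i) < d ->
      \sum_i `|F (v i) - F (u i)| < e.
Proof.
move=> acF e0; have [d d0 acd] := acF e e0; exists d => // I u v uv tuv sd.
have ebij : bijective (@enum_val I predT).
  exact: (Bijective (@enum_valK I) (@enum_rankK I)).
rewrite (reindex _ (onW_bij _ ebij)).
apply: (acd _ (u \o enum_val) (v \o enum_val)) => [i||]; first exact: uv.
- apply/trivIsetP => i j _ _ ij; apply: (trivIsetP.1 tuv) => //.
  by apply: contra ij => /eqP/enum_val_inj ->.
- by move: sd; rewrite (reindex _ (onW_bij _ ebij)).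
Qed.

(** Subdividing every interval of a disjoint family gives a disjoint family of the same total
    length, so the same [d] serves. *)
Lemma abs_continuous_on_variation (R : realType) (a b : R) (F : R -> R) (e : R) :
  abs_continuous_on a b F -> 0 < e -> exists2 d : R, 0 < d &
    forall (m : nat) (u v : 'I_m -> R) (s : 'I_m -> seq R),
      (forall i, a <= u i /\ u i <= v i /\ v i <= b) ->
      trivIset [set: 'I_m] (fun i => `]u i, v i[%classic) ->
      \sum_i (v i - u i) < d ->
      (forall i, itv_partition (u i) (v i) (s i)) ->
      \sum_i variation (u i) (v i) F (s i) < e.
Proof.
move=> acF e0; have [d d0 acd] := abs_continuous_on_fin acF e0.
exists d => // m u v s uv tuv sd sP.
(* The nodes of the [i]-th partition, from node 0, which is [u i], to node [size (s i)], which is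
   [v i]. *)
pose x i k := nth (v i) (u i :: s i) k.
have xmono i k l : (k <= l <= size (s i))%N -> x i k <= x i l.
  move=> /andP[kl ls]; have [p _] := sP i.
  have p' : sorted <%R (u i :: s i) by [].
  by rewrite /x (lt_sorted_leq_nth _ p')// inE/= ltnS// (leq_trans kl).
have sum_part (g : R -> R -> R) : \sum_i \sum_(0 <= k < size (s i)) g (x i k) (x i k.+1) =
    \sum_(p : {i : 'I_m & 'I_(size (s i))}) g (x (tag p) (tagged p)) (x (tag p) (tagged p).+1).
  rewrite -(sig_big_dep xpredT (fun _ _ => true) (fun i (k : 'I_(size (s i))) => g (x i k) (x i k.+1))) /=.
  by apply: eq_bigr => i _; rewrite big_mkord.
rewrite [X in X < _](sum_part (fun y z => `|F z - F y|)).
have szx i : x i (size (s i)) = v i by apply: itv_partition_nth_size; exact: sP.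
rewrite /=; apply: (acd {i : 'I_m & 'I_(size (s i))}
  (fun p => x (tag p) (tagged p)) (fun p => x (tag p) (tagged p).+1)).
- move=> [i k]/=; have [au [_ vb]] := uv i.
  split; first by apply: (le_trans au); apply: (xmono i 0%N); rewrite /= ltnW.
  split; first by apply: xmono; rewrite leqnSn/=.
  by apply: le_trans vb; rewrite -szx; apply: xmono; rewrite ltn_ord/=.
(* A point common to two cells lies in both outer intervals, which forces [i = j]; monotonicity of
   the nodes then forces [k = l]. *)
- move=> [i k] [j l] _ _ /= [y [/=]]; rewrite !in_itv/= => /andP[ky yk] /andP[ly yl].
  have sub i' (k' : 'I_(size (s i'))) : x i' k' < y -> y < x i' k'.+1 -> `]u i', v i'[%classic y.
    move=> h1 h2; rewrite /= in_itv/=; apply/andP; split.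
      by apply: le_lt_trans h1; apply: (xmono i' 0%N); rewrite /= ltnW.
    by apply: (lt_le_trans h2); rewrite -szx; apply: xmono; rewrite ltn_ord/=.
  have ij : i = j by apply: tuv => //; exists y; split; [exact: sub ky yk|exact: sub ly yl].
  subst j; congr existT; apply/val_inj => /=.
  have [kl|lk|//] := ltngtP k l.
  + have := lt_trans ly yk; rewrite ltNge xmono//.
    by rewrite kl/= ltnW.
  + have := lt_trans ky yl; rewrite ltNge xmono//.
    by rewrite lk/= ltnW.
- rewrite -(sum_part (fun y z => z - y)).
  by under eq_bigr => i _ do rewrite telescope_sumr// szx.
Qed.

(** For tolerance 1, the variation over any interval shorter than [d] is less than 1. Finitely many
    steps of length [d / 2] cover [[a, b]], and total variation is additive. *)
Lemma abs_continuous_on_bounded_variation (R : realType) (a b : R) (F : R -> R) :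
  a <= b -> abs_continuous_on a b F -> bounded_variation a b F.
Proof.
move=> ab acF; have [d d0 acd] := abs_continuous_on_variation acF ltr01.
have small x y : a <= x -> x <= y -> y <= b -> y - x < d -> bounded_variation x y F.
  move=> ax xy yb xyd; exists 1 => _ [s sP <-]; apply/ltW.
  have := acd 1%N (fun=> x) (fun=> y) (fun=> s); rewrite !big_ord1; apply=> //.
  by move=> i j _ _ _; rewrite (ord1 i) (ord1 j).
have step k x : a <= x -> x <= b -> x - a < k%:R * (d / 2) -> total_variation a x F \is a fin_num.
  elim: k x => [x ax _|k ih x ax xb xk].
    by rewrite mul0r ltNge subr_ge0 ax.
  have [axd|axd] := leP (x - d / 2) a.
    by apply/bounded_variationP => //; apply: small => //; lra.
  rewrite (@total_variationD _ a x (x - d / 2)); [|lra|lra].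
  rewrite fin_numD ih; [|lra|lra|]; last first.
    by move: xk; rewrite -natr1 mulrDl mul1r; lra.
  by apply/bounded_variationP; [lra|apply: small => //; lra].
apply/bounded_variationP => //; apply: (step (Num.trunc ((b - a) / (d / 2))).+1) => //.
rewrite -ltr_pdivrMr; last lra.
exact: Num.Theory.truncnS_gt.
Qed.

(** An increment of the variation function is a total variation, hence within [e / 2 / m.+1] of the
    variation along some partition. These partition variations sum to less than [e / 2], and the [m]
    errors to at most [e / 2]; [m.+1] keeps the divisor nonzero. *)
Lemma abs_continuous_on_total_variation (R : realType) (a b : R) (F : R -> R) :
  a <= b -> abs_continuous_on a b F ->
  abs_continuous_on a b (fun x => fine (total_variation a x F)).
Proof.
move=> ab acF e e0; have e20 : 0 < e / 2 by lra.
have bvF := abs_continuous_on_bounded_variation ab acF.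
have [d d0 acd] := abs_continuous_on_variation acF e20.
exists d => // m u v uv tuv sd.
have fin x y : a <= x -> x <= y -> y <= b -> total_variation x y F \is a fin_num.
  move=> ax xy yb; apply/bounded_variationP => //.
  by apply: (bounded_variationl xy yb); apply: (bounded_variationr ax _ bvF); exact: le_trans yb.
have eta0 : 0 < e / 2 / m.+1%:R by rewrite divr_gt0// ltr0n.
have /choice[s] : forall i, exists s, itv_partition (u i) (v i) s /\
    fine (total_variation (u i) (v i) F) < variation (u i) (v i) F s + e / 2 / m.+1%:R.
  move=> i; have [au [uvi vb]] := uv i.
  have [_ [_ [s sP <-] <-] h] := ub_ereal_sup_adherent eta0 (fin _ _ au uvi vb).
  exists s; split => //; rewrite -ltrBlDr -lte_fin EFinB fineK//.
  exact: fin.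
move=> /all_and2[sP sv].
apply: (@le_lt_trans _ _ (\sum_i (variation (u i) (v i) F (s i) + e / 2 / m.+1%:R))).
  apply: ler_sum => i _; have [au [uvi vb]] := uv i.
  rewrite (total_variationD F au uvi) fineD ?fin//; last exact: le_trans vb.
  rewrite addrAC subrr add0r ger0_norm; first exact/ltW.
  by rewrite fine_ge0// total_variation_ge0.
rewrite big_split/= sumr_const card_ord.
apply: (@lt_le_trans _ _ (e / 2 + e / 2)); last lra.
apply: ltr_leD; first exact: acd.
rewrite -[_ *+ m]mulr_natr -mulrA.
rewrite -[leRHS]mulr1 ler_wpM2l//; first exact: ltW.
by rewrite ler_pdivrMl ?ltr0n// mulr1 ler_nat.
Qed.

(** The density is the Radon-Nikodym derivative of the Stieltjes measure of [G], which
    [stieltjes_dominated] shows to be dominated by Lebesgue measure. *)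
Lemma nondecreasing_abs_continuous_density (R : realType) (a b : R) (G : R -> R) :
  a <= b -> {in `[a, b] &, nondecreasing_fun G} -> abs_continuous_on a b G ->
  exists2 g : R -> R, (@lebesgue_measure R).-integrable `[a, b] (EFin \o g) &
    forall x, x \in `[a, b] -> G x - G a = \int[@lebesgue_measure R]_(t in `[a, x]) g t.
Proof.
(* A cumulative function lives on the whole line, so [G] is extended by its end values, as
   [G \o clip]. Since [clip] is monotone and 1-Lipschitz, absolute continuity survives. *)
move=> ab ndG acG; pose clip x := Num.max a (Num.min x b).
have clipP x : [\/ x < a /\ clip x = a, (a <= x /\ x <= b) /\ clip x = x | b < x /\ clip x = b].
  rewrite /clip; case: (leP x b) => xb; last first.
    by rewrite max_r//; apply: Or33.
  by case: (leP a x) => ax; [apply: Or32|apply: Or31].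
have clipab x : a <= clip x <= b.
  by rewrite /clip le_max lexx/= ge_max ab ge_min lexx orbT.
have clip_nd x y : x <= y -> clip x <= clip y.
  by move=> xy; case: (clipP x) => -[? ->]; case: (clipP y) => -[? ->]; lra.
have clip_lip x y : x <= y -> clip y - clip x <= y - x.
  by move=> xy; case: (clipP x) => -[? ->]; case: (clipP y) => -[? ->]; lra.
have clipE x : a <= x -> x <= b -> clip x = x.
  by move=> ax xb; rewrite /clip min_l// max_r.
(* A point strictly between clipped endpoints is fixed by [clip], hence lies between the original
   ones; clipping therefore preserves disjointness. *)
have clipoo u v z : clip u < z < clip v -> u < z < v.
  move=> /andP[uz zv]; have /andP[au _] := clipab u; have /andP[_ vb] := clipab v.
  have zE := clipE z (le_trans au (ltW uz)) (le_trans (ltW zv) vb).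
  apply/andP; split; rewrite ltNge; apply/negP => /clip_nd; rewrite zE => h.
    by have := le_lt_trans h uz; rewrite ltxx.
  by have := lt_le_trans zv h; rewrite ltxx.
have tclip m (u v : 'I_m -> R) : trivIset [set: 'I_m] (fun i => `]u i, v i[%classic) ->
    trivIset [set: 'I_m] (fun i => `]clip (u i), clip (v i)[%classic).
  move=> tuv i j _ _ [z [/= zi zj]]; apply: tuv => //; exists z.
  by move: zi zj; rewrite /= !in_itv/= => /clipoo ? /clipoo.
pose H x := G (clip x).
have ndH : {homo H : x y / x <= y}.
  by move=> x y xy; apply: ndG; rewrite ?in_itv/=; [exact: clipab|exact: clipab|exact: clip_nd].
have acH e : 0 < e -> exists2 d : R, 0 < d & forall (m : nat) (u v : 'I_m -> R),
      (forall i, u i <= v i) ->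
      trivIset [set: 'I_m] (fun i => `]u i, v i[%classic) ->
      \sum_(i < m) (v i - u i) < d ->
      \sum_(i < m) (H (v i) - H (u i)) < e.
  move=> e0; have [d d0 acd] := acG e e0; exists d => // m u v uv tuv sd.
  apply: le_lt_trans (acd m (clip \o u) (clip \o v) _ _ _).
  - by apply: ler_sum => i _; exact: ler_norm.
  - move=> i; have /andP[? ?] := clipab (u i); have /andP[? ?] := clipab (v i).
    by split => //; split => //; exact/clip_nd/uv.
  - exact: tclip.
  - by apply: le_lt_trans sd; apply: ler_sum => i _; exact: clip_lip.
have rcH : right_continuous H.
  move=> x; apply/cvgrPdist_lt => e e0; have [d d0 acd] := acH e e0.
  have : \forall y \near x^'+, x < y < x + d.
    near=> y; apply/andP; split; near: y; first exact: nbhs_right_gt.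
    by apply: nbhs_right_lt; rewrite ltrDl.
  apply: filterS => y /andP[xy yd].
  rewrite distrC ger0_norm ?subr_ge0; last by apply/ndH/ltW.
  have := acd 1%N (fun=> x) (fun=> y); rewrite !big_ord1; apply.
  - by move=> _; exact: ltW.
  - by move=> i j _ _ _; rewrite (ord1 i) (ord1 j).
  - by rewrite ltrBlDl.
pose Hc : cumulative R R := HB.pack H (isCumulative.Build R _ R H ndH rcH).
have HG x : x \in `[a, b] -> Hc x = G x.
  by rewrite in_itv/= => /andP[ax xb]; rewrite /= /H clipE.
have dom := @stieltjes_dominated R Hc acH.
pose nu := lebesgue_stieltjes_measure Hc.
have nuE x y : x <= y -> nu `]x, y]%classic = (Hc y - Hc x)%:E.
  exact: lebesgue_stieltjes_measure_itvoc.
have mab : measurable (`]a, b]%classic : set (measurableTypeR R)) by exact: measurable_itv.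
have nufin : (nu `]a, b]%classic < +oo)%E by rewrite nuE ?ltry.
(* Restriction to []a, b]] yields a finite measure, so that the density is integrable. *)
pose nu' := mfrestr mab nufin.
have dom' : nu' `<< @lebesgue_measure R.
  apply/null_content_dominatesP => A mA A0; rewrite /nu' /mfrestr/= /mrestr.
  have /null_content_dominatesP dom1 := dom.
  apply: dom1; first exact: measurableI.
  apply/eqP; rewrite eq_le measure_ge0 andbT -A0.
  by apply: le_measure; [rewrite inE; exact: measurableI|rewrite inE|exact: subIsetl].
pose f := Radon_Nikodym_SigmaFinite.f nu' (@lebesgue_measure R).
have ffin x : f x \is a fin_num by exact: Radon_Nikodym_SigmaFinite.f_fin_num.
have fint := Radon_Nikodym_SigmaFinite.f_integrable dom'.
have fE := Radon_Nikodym_SigmaFinite.f_integral dom'.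
have gf : EFin \o (fine \o f) = f by apply/funext => x /=; rewrite fineK.
exists (fine \o f).
  by rewrite gf; apply: integrableS fint => //; exact: measurable_itv.
move=> x xab; have := xab; rewrite in_itv/= => /andP[ax xb].
rewrite -Rintegral_itv_obnd_cbnd; last first.
  by rewrite gf; apply: integrableS fint => //; exact: measurable_itv.
transitivity (fine (nu (`]a, x]%classic `&` `]a, b]%classic))); last first.
  rewrite /Rintegral (eq_integral f); last by move=> z _; rewrite /= fineK.
  by congr fine; apply: fE; exact: measurable_itv.
rewrite setIidl; last first.
  by move=> z /=; rewrite !in_itv/= => /andP[-> /le_trans]; apply.
by rewrite nuE// !HG// in_itv/= lexx.
Unshelve. all: by end_near. Qed.

(** * Derivatives relative to a set *)

(** The relational form keeps the rules of calculus free of junk values; [has_deriv_in_lim]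
    transfers results to [derive1_in]. *)
Definition has_deriv_in (R : realType) (A : set R) (F : R -> R) (x l : R) : Prop :=
  (F y - F x) / (y - x) @[y --> within A x^'] --> l.

Lemma has_deriv_in_sub (R : realType) (A B : set R) (F : R -> R) (x l : R) :
  B `<=` A -> has_deriv_in A F x l -> has_deriv_in B F x l.
Proof.
move=> BA; apply: cvg_trans; apply: cvg_app => U AU.
exact: (@filterS _ x^' _ (fun y => A y -> U y) (fun y => B y -> U y)
  (fun y AUy By => AUy (BA y By)) AU).
Qed.

Lemma has_deriv_in_eq (R : realType) (A : set R) (F G : R -> R) (x l : R) :
  A x -> {in A, F =1 G} -> has_deriv_in A F x l -> has_deriv_in A G x l.
Proof.
move=> Ax FG; apply: cvg_trans; apply: near_eq_cvg; rewrite near_withinE.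
by apply: nearW => y Ay; rewrite !FG// inE.
Qed.

Lemma is_derive_has_deriv_in (R : realType) (A : set R) (F : R -> R) (x l : R) :
  is_derive x 1 F l -> has_deriv_in A F x l.
Proof.
move=> [dF Fl]; apply: cvg_within_filter.
have : h^-1 *: (F (h *: 1 + x) - F x) @[h --> 0^'] --> l by rewrite -Fl.
move=> /cvgrPdist_lt h; apply/cvgrPdist_lt => e /h.
rewrite !near_withinE => /nbhs_ballP[d d0 bd]; apply/nbhs_ballP; exists d => // y xy yx.
have := bd (y - x); rewrite /ball/= sub0r normrN -normrN opprB => /(_ xy).
rewrite subr_eq0 => /(_ yx).
by rewrite [(_ - _) *: 1]mulr1 subrK mulrC.
Qed.

(** Each point of a nondegenerate segment is an accumulation point of it. Uniqueness of relative
    derivatives, endpoints included, rests on this. *)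
Lemma within_dnbhs_itv_proper (R : realType) (a b x : R) : a < b -> x \in `[a, b] ->
  ProperFilter (within `[a, b]%classic x^').
Proof.
move=> ab; rewrite in_itv/= => /andP[ax xb].
apply: Build_ProperFilter_ex => U FU.
have : \forall y \near x^', `[a, b]%classic y -> U y by exact: FU.
rewrite near_withinE => /nbhs_ballP[d /= d0 bd].
(* The witness is a step of at most [d / 2] to the right of [x], or to the left when [x = b],
   truncated so as to stay in [[a, b]]. *)
have [xb'|bx] := ltP x b.
  exists (Num.min b (x + d / 2)); apply: bd; case: (leP b (x + d / 2)) => ?.
  - by rewrite /ball/= ltr0_norm; lra.
  - by rewrite /ball/= ltr0_norm; lra.
  - by apply/eqP; lra.
  - by apply/eqP; lra.
  - by rewrite /= in_itv/=; lra.
  - by rewrite /= in_itv/=; lra.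
exists (Num.max a (x - d / 2)); apply: bd; case: (leP a (x - d / 2)) => ?.
- by rewrite /ball/= ger0_norm; lra.
- by rewrite /ball/= ger0_norm; lra.
- by apply/eqP; lra.
- by apply/eqP; lra.
- by rewrite /= in_itv/=; lra.
- by rewrite /= in_itv/=; lra.
Qed.

Lemma has_deriv_in_unique (R : realType) (a b : R) (F : R -> R) (x l l' : R) :
  a < b -> x \in `[a, b] -> has_deriv_in `[a, b] F x l -> has_deriv_in `[a, b] F x l' -> l = l'.
Proof.
move=> ab xab Fl Fl'; have := within_dnbhs_itv_proper ab xab => pf.
exact: cvg_unique Fl Fl'.
Qed.

Lemma has_deriv_in_lim (R : realType) (a b : R) (F : R -> R) (x l : R) :
  a < b -> x \in `[a, b] -> has_deriv_in `[a, b] F x l -> derive1_in `[a, b] F x = l.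
Proof.
move=> ab xab Fl; have := within_dnbhs_itv_proper ab xab => pf.
exact: cvg_lim Fl.
Qed.

(** Convergence of a filter is by definition convergence to its [lim]. *)
Lemma derivable_in_has_deriv (R : realType) (A : set R) (F : R -> R) (x : R) :
  derivable_in A F x -> has_deriv_in A F x (derive1_in A F x).
Proof. by []. Qed.

Lemma has_deriv_in_cvg (R : realType) (A : set R) (F : R -> R) (x l : R) :
  has_deriv_in A F x l -> F y @[y --> within A x^'] --> F x.
Proof.
move=> Fl.
have : (F y - F x) / (y - x) * (y - x) + F x @[y --> within A x^'] --> l * (x - x) + F x.
  apply: cvgD; last exact: cvg_cst.
  apply: cvgM => //; apply: cvgB; last exact: cvg_cst.
  do 2 apply: cvg_within_filter; exact: cvg_id.
rewrite subrr mulr0 add0r; apply: cvg_trans; apply: near_eq_cvg.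
rewrite !near_withinE; apply: nearW => y yx _.
by rewrite divfK ?subr_eq0// subrK.
Qed.

Lemma has_deriv_inD (R : realType) (A : set R) (F G : R -> R) (x l k : R) :
  has_deriv_in A F x l -> has_deriv_in A G x k ->
  has_deriv_in A (fun y => F y + G y) x (l + k).
Proof.
move=> Fl Gk; rewrite /has_deriv_in (_ : (fun y => _) =
  (fun y => (F y - F x) / (y - x) + (G y - G x) / (y - x))); last by apply/funext => y; ring.
exact: cvgD.
Qed.

Lemma has_deriv_inM (R : realType) (A : set R) (F G : R -> R) (x l k : R) :
  has_deriv_in A F x l -> has_deriv_in A G x k ->
  has_deriv_in A (fun y => F y * G y) x (l * G x + F x * k).
Proof.
move=> Fl Gk; rewrite /has_deriv_in (_ : (fun y => _) =
  (fun y => (F y - F x) / (y - x) * G y + F x * ((G y - G x) / (y - x)))); last by apply/funext => y; ring.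
apply: cvgD; apply: cvgM => //; [exact: has_deriv_in_cvg Gk|exact: cvg_cst].
Qed.

Lemma has_deriv_in_cst (R : realType) (A : set R) (x k : R) : has_deriv_in A (fun=> k) x 0.
Proof.
rewrite /has_deriv_in; under eq_fun do rewrite subrr mul0r.
exact: cvg_cst.
Qed.

Lemma has_deriv_in_sum (R : realType) (A : set R) (n : nat) (F : nat -> R -> R) (l : nat -> R) (x : R) :
  (forall i, (i < n)%N -> has_deriv_in A (F i) x (l i)) ->
  has_deriv_in A (fun y => \sum_(0 <= i < n) F i y) x (\sum_(0 <= i < n) l i).
Proof.
elim: n => [_|n ih h].
  by rewrite big_geq//; under eq_fun do rewrite big_geq//; exact: has_deriv_in_cst.
rewrite big_nat_recr//=; under eq_fun do rewrite big_nat_recr//=.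
by apply: has_deriv_inD; [apply: ih => i /ltnW/h|exact: h].
Qed.

Lemma has_deriv_in_horner (R : realType) (A : set R) (p : {poly R}) (x : R) :
  has_deriv_in A (fun y => p.[y]) x (p^`()).[x].
Proof.
apply: is_derive_has_deriv_in; rewrite derivE derive1E.
by apply: DeriveDef; first exact: derivable_horner.
Qed.

(** * The fundamental theorem of calculus for absolutely continuous functions *)

(** Jordan decomposition [F = T - (T - F)]: by [TD] the increments of [T] dominate those of [F] in
    absolute value, so both terms are nondecreasing, and their densities subtract. *)
Lemma abs_continuous_on_density (R : realType) (a b : R) (F : R -> R) :
  a <= b -> abs_continuous_on a b F ->
  exists2 g : R -> R, (@lebesgue_measure R).-integrable `[a, b] (EFin \o g) &
    forall x, x \in `[a, b] -> F x - F a = \int[@lebesgue_measure R]_(t in `[a, x]) g t.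
Proof.
move=> ab acF; pose T x := fine (total_variation a x F).
have bvF := abs_continuous_on_bounded_variation ab acF.
have fin x y : a <= x -> x <= y -> y <= b -> total_variation x y F \is a fin_num.
  move=> ax xy yb; apply/bounded_variationP => //.
  by apply: (bounded_variationl xy yb); apply: (bounded_variationr ax _ bvF); exact: le_trans yb.
have TD x y : a <= x -> x <= y -> y <= b -> `|F y - F x| <= T y - T x.
  move=> ax xy yb; rewrite /T (total_variationD F ax xy) fineD ?fin//; last exact: le_trans yb.
  rewrite addrAC subrr add0r -lee_fin fineK ?fin//.
  exact: total_variation_ge.
have acT : abs_continuous_on a b T by exact: abs_continuous_on_total_variation.
have acTF : abs_continuous_on a b (fun x => T x - F x).
  move=> e e0; have e20 : 0 < e / 2 by lra.
  have [d1 d10 h1] := acT _ e20; have [d2 d20 h2] := acF _ e20.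
  exists (Num.min d1 d2) => [|m u v uv tuv]; first by rewrite lt_min d10.
  rewrite lt_min => /andP[/(h1 _ _ _ uv tuv) s1 /(h2 _ _ _ uv tuv) s2].
  apply: (@le_lt_trans _ _ (\sum_i (`|T (v i) - T (u i)| + `|F (v i) - F (u i)|))).
    apply: ler_sum => i _; apply: le_trans (ler_normB _ _).
    by rewrite le_eqVlt; apply/predU1P; left; congr `| _ |; ring.
  by rewrite big_split/=; lra.
have [|g1 ig1 g1E] := @nondecreasing_abs_continuous_density R a b T ab _ acT.
  move=> x y; rewrite !in_itv/= => /andP[ax xb] /andP[ay yb] xy.
  by have := TD x y ax xy yb; have := normr_ge0 (F y - F x); lra.
have [|g2 ig2 g2E] := @nondecreasing_abs_continuous_density R a b _ ab _ acTF.
  move=> x y; rewrite !in_itv/= => /andP[ax xb] /andP[ay yb] xy.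
  by have := TD x y ax xy yb; have := ler_norm (F y - F x); lra.
have mab y : measurable (`[a, y]%classic : set (measurableTypeR R)) by exact: measurable_itv.
exists (fun x => g1 x - g2 x); first by have := integrableB (mab b) ig1 ig2.
move=> x xab; have /andP[ax xb] : a <= x <= b by rewrite in_itv in xab.
rewrite RintegralB//; last 2 first.
- by apply: integrableS ig1 => // z; rewrite /= !in_itv/= => /andP[-> /le_trans]; apply.
- by apply: integrableS ig2 => // z; rewrite /= !in_itv/= => /andP[-> /le_trans]; apply.
by rewrite -g1E// -g2E//; lra.
Qed.

Lemma ae_imply (R : realType) (P Q : R -> Prop) : (forall x, P x -> Q x) ->
  {ae @lebesgue_measure R, forall x, P x} -> {ae @lebesgue_measure R, forall x, Q x}.
Proof.
by move=> PQ; apply: filterS; first exact: (ae_filter_ringOfSetsType lebesgue_measure).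
Qed.

Lemma ae_imply2 (R : realType) (P Q S : R -> Prop) : (forall x, P x -> Q x -> S x) ->
  {ae @lebesgue_measure R, forall x, P x} -> {ae @lebesgue_measure R, forall x, Q x} ->
  {ae @lebesgue_measure R, forall x, S x}.
Proof.
by move=> PQ; apply: filterS2; first exact: (ae_filter_ringOfSetsType lebesgue_measure).
Qed.

(** On [[a, b]], [F] is the constant [F a] plus the indefinite integral of its density [g], and
    Lebesgue differentiation gives that integral the derivative [g] almost everywhere. *)
Lemma abs_continuous_on_has_deriv_in (R : realType) (a b : R) (F : R -> R) :
  a < b -> abs_continuous_on a b F ->
  exists g : R -> R, [/\ (@lebesgue_measure R).-integrable `[a, b] (EFin \o g),
    F b - F a = \int[@lebesgue_measure R]_(t in `[a, b]) g t &
    {ae @lebesgue_measure R, forall x, a < x < b -> has_deriv_in `[a, b] F x (g x)}].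
Proof.
move=> ab acF; have [g ig gE] := abs_continuous_on_density (ltW ab) acF.
exists g; split => //; first by apply: gE; rewrite in_itv/= (ltW ab) lexx.
have mab : measurable (`[a, b]%classic : set (measurableTypeR R)) by exact: measurable_itv.
(* Extension by zero makes the density integrable on the whole line, as [FTC1] requires local
   integrability there. *)
pose g' := g \_ `[a, b]%classic.
have locg : locally_integrable setT g' by exact: integrable_locally.
have ig' y : (@lebesgue_measure R).-integrable [set` Interval (BLeft a) (BRight y)] (EFin \o g').
  apply: (@integrableS _ _ _ _ setT) => //.
  rewrite (_ : EFin \o g' = (EFin \o g) \_ `[a, b]); last by rewrite /g' restrict_EFin.
  by apply/(integrable_mkcond _ _).1.
apply: ae_imply (FTC1 ig' locg) => x + /andP[ax xb].
rewrite /= lte_fin => /(_ ax); set I := (fun x : R => _) => -[dI Ix].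
have hI : has_deriv_in `[a, b] I x (g x).
  apply: is_derive_has_deriv_in; apply: DeriveDef => //.
  by rewrite -derive1E Ix /g' patchE mem_set//= in_itv/= !ltW.
have := has_deriv_inD hI (has_deriv_in_cst `[a, b] x (F a)); rewrite addr0.
apply: has_deriv_in_eq; first by rewrite /= in_itv/= !ltW.
move=> y; rewrite inE/= => yab; apply: (addIr (- F a)); rewrite addrK gE//.
apply: eq_Rintegral => z; rewrite inE/= => zay; rewrite /g' patchE mem_set//=.
move: zay yab; rewrite !in_itv/= => /andP[-> zy] /andP[_].
exact: le_trans.
Qed.

Lemma Rintegral_itvcc_itvoo (R : realType) (a b : R) (h : R -> R) :
  (@lebesgue_measure R).-integrable `[a, b] (EFin \o h) ->
  \int[@lebesgue_measure R]_(t in `[a, b]) h t = \int[@lebesgue_measure R]_(t in `]a, b[) h t.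
Proof.
move=> ih; rewrite -Rintegral_itv_obnd_cbnd; last first.
  by apply: integrableS ih => //; exact: subset_itv_oc_cc.
rewrite -Rintegral_itv_bndo_bndc//.
by apply: integrableS ih => //; exact: subset_itv_oo_cc.
Qed.

(** Relative derivatives are unique, so [f] agrees almost everywhere with the density of [F], whose
    integral is the increment. *)
Lemma abs_continuous_on_FTC (R : realType) (a b : R) (F f : R -> R) :
  a < b -> abs_continuous_on a b F ->
  (@lebesgue_measure R).-integrable `[a, b] (EFin \o f) ->
  {ae @lebesgue_measure R, forall x, a < x < b -> has_deriv_in `[a, b] F x (f x)} ->
  \int[@lebesgue_measure R]_(t in `[a, b]) f t = F b - F a.
Proof.
move=> ab acF intf aef; have [g [ig -> aeg]] := abs_continuous_on_has_deriv_in ab acF.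
have sub : `]a, b[ `<=` `[a, b] by exact: subset_itv_oo_cc.
rewrite !Rintegral_itvcc_itvoo//; congr fine; apply: ae_eq_integral => //=.
- by have /integrableP[/measurable_funS + _] := intf; apply.
- by have /integrableP[/measurable_funS + _] := ig; apply.
apply: ae_imply2 aef aeg => x h1 h2; rewrite /= in_itv/= => xab; congr EFin.
apply: (has_deriv_in_unique ab _ (h1 xab) (h2 xab)).
by apply: sub; rewrite /= in_itv.
Qed.

(** * Stability properties of absolute continuity and Lipschitz criteria *)

Lemma abs_continuous_on_sub (R : realType) (a b c d : R) (F : R -> R) :
  a <= c -> d <= b -> abs_continuous_on a b F -> abs_continuous_on c d F.
Proof.
move=> ac db acF e /acF[r r0 h]; exists r => // m u v uv; apply: h => i.
by have [? [? ?]] := uv i; split; [exact: le_trans ac _|split => //; exact: le_trans db].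
Qed.

Lemma lipschitz_abs_continuous_on (R : realType) (a b L : R) (F : R -> R) :
  (forall x y, a <= x -> x <= y -> y <= b -> `|F y - F x| <= L * (y - x)) ->
  abs_continuous_on a b F.
Proof.
move=> lipF e e0; exists (e / (`|L| + 1)) => [|m u v uv _].
  by rewrite divr_gt0// ltr_wpDl.
rewrite ltr_pdivlMr ?ltr_wpDl// mulr_suml; apply: le_lt_trans.
apply: ler_sum => i _; have [au [uvi vb]] := uv i.
apply: le_trans (lipF _ _ au uvi vb) _; rewrite mulrC ler_wpM2l ?subr_ge0//.
by have := ler_norm L; lra.
Qed.

(** The density [g] gives the explicit bound [|F a|] plus the integral of [|g|]. *)
Lemma abs_continuous_on_bounded (R : realType) (a b : R) (F : R -> R) :
  a <= b -> abs_continuous_on a b F ->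
  exists M : R, forall x, a <= x -> x <= b -> `|F x| <= M.
Proof.
move=> ab acF; have [g ig gE] := abs_continuous_on_density ab acF.
exists (`|F a| + \int[@lebesgue_measure R]_(t in `[a, b]) `|g t|) => x ax xb.
rewrite -[F x](subrK (F a)) addrC; apply: le_trans (ler_normD _ _) _.
rewrite lerD2l gE; last by rewrite in_itv/= ax.
have sub : `[a, x] `<=` `[a, b] by move=> z /=; rewrite !in_itv/= => /andP[-> /le_trans]; apply.
have igx : (@lebesgue_measure R).-integrable `[a, x] (EFin \o g) by apply: integrableS ig.
apply: le_trans (le_normr_Rintegral _ igx) _ => //.
have igb : (@lebesgue_measure R).-integrable `[a, b] (EFin \o (fun t => `|g t|)) by exact: integrable_norm.
apply: fine_le.
- by apply: integrable_fin_num => //; exact: integrable_norm.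
- exact: integrable_fin_num.
- by apply: ge0_subset_integral => //; move/integrableP : igb => [].
Qed.

Lemma abs_continuous_onD (R : realType) (a b : R) (F G : R -> R) :
  abs_continuous_on a b F -> abs_continuous_on a b G ->
  abs_continuous_on a b (fun x => F x + G x).
Proof.
move=> acF acG e e0; have e20 : 0 < e / 2 by lra.
have [d1 d10 h1] := acF _ e20; have [d2 d20 h2] := acG _ e20.
exists (Num.min d1 d2) => [|m u v uv tuv]; first by rewrite lt_min d10.
rewrite lt_min => /andP[/(h1 _ _ _ uv tuv) s1 /(h2 _ _ _ uv tuv) s2].
apply: (@le_lt_trans _ _ (\sum_i (`|F (v i) - F (u i)| + `|G (v i) - G (u i)|))).
  apply: ler_sum => i _; apply: le_trans (ler_normD _ _).
  by rewrite le_eqVlt; apply/predU1P; left; congr `| _ |; ring.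
by rewrite big_split/=; lra.
Qed.

Lemma abs_continuous_onM (R : realType) (a b : R) (F G : R -> R) :
  a <= b -> abs_continuous_on a b F -> abs_continuous_on a b G ->
  abs_continuous_on a b (fun x => F x * G x).
Proof.
move=> ab acF acG e e0.
have [M FM] := abs_continuous_on_bounded ab acF.
have [N GN] := abs_continuous_on_bounded ab acG.
have M0 : 0 <= M by apply: le_trans (FM a _ _).
have N0 : 0 <= N by apply: le_trans (GN a _ _).
(* A common bound for both factors; the added 1 makes it positive, so that [e / 2 / K] is a valid
   tolerance. *)
pose K := M + N + 1; have K0 : 0 < K by rewrite /K; lra.
have e20 : 0 < e / 2 / K by rewrite !divr_gt0.
have [d1 d10 h1] := acF _ e20; have [d2 d20 h2] := acG _ e20.
exists (Num.min d1 d2) => [|m u v uv tuv]; first by rewrite lt_min d10.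
rewrite lt_min => /andP[/(h1 _ _ _ uv tuv) s1 /(h2 _ _ _ uv tuv) s2].
apply: (@le_lt_trans _ _ (\sum_i (K * `|F (v i) - F (u i)| + K * `|G (v i) - G (u i)|))).
  apply: ler_sum => i _; have [au [uvi vb]] := uv i.
  have -> : F (v i) * G (v i) - F (u i) * G (u i) =
      G (v i) * (F (v i) - F (u i)) + F (u i) * (G (v i) - G (u i)) by ring.
  apply: le_trans (ler_normD _ _) _; rewrite !normrM; apply: lerD; apply: ler_wpM2r => //.
    by have := GN (v i) (le_trans au uvi) vb; rewrite /K; lra.
  by have := FM (u i) au (le_trans uvi vb); rewrite /K; lra.
rewrite big_split/= -!mulr_sumr.
by move: s1 s2; rewrite !ltr_pdivlMr// mulrC => s1; rewrite mulrC => s2; lra.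
Qed.

Lemma abs_continuous_on_sum (R : realType) (a b : R) (n : nat) (F : nat -> R -> R) :
  (forall i, (i < n)%N -> abs_continuous_on a b (F i)) ->
  abs_continuous_on a b (fun x => \sum_(0 <= i < n) F i x).
Proof.
elim: n => [_|n ih h].
  move=> e e0; exists 1 => // m u v _ _ _.
  by rewrite big1// => i _; rewrite !big_geq// subrr normr0.
rewrite (_ : (fun x => _) = (fun x => \sum_(0 <= i < n) F i x + F n x)); last first.
  by apply/funext => x; rewrite big_nat_recr.
by apply: abs_continuous_onD; [apply: ih => i /ltnW/h|exact: h].
Qed.

Lemma abs_continuous_on_within_continuous (R : realType) (a b : R) (F : R -> R) :
  abs_continuous_on a b F -> {within `[a, b], continuous F}.
Proof.
move=> acF; apply/subspace_continuousP => x; rewrite /= in_itv/= => /andP[ax xb].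
apply/cvgrPdist_lt => e e0; have [d d0 h] := acF e e0.
rewrite near_withinE; apply/nbhs_ballP; exists d => // y; rewrite /ball/= in_itv/= => xyd /andP[ay yb].
have dist u v : a <= u -> u <= v -> v <= b -> v - u < d -> `|F v - F u| < e.
  move=> au uv vb uvd; have := h 1%N (fun=> u) (fun=> v); rewrite !big_ord1; apply=> //.
  by move=> i j _ _ _; rewrite (ord1 i) (ord1 j).
have [xy|yx] := leP x y.
  by rewrite distrC; apply: dist => //; move: xyd; rewrite ler0_norm; lra.
by apply: dist => //; [exact: ltW|move: xyd; rewrite ger0_norm; lra].
Qed.

Lemma abs_continuous_on_integrable (R : realType) (a b : R) (F : R -> R) :
  abs_continuous_on a b F -> (@lebesgue_measure R).-integrable `[a, b] (EFin \o F).
Proof.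
move=> acF; apply: continuous_compact_integrable; first exact: segment_compact.
exact: abs_continuous_on_within_continuous.
Qed.

Lemma has_deriv_in_is_derive (R : realType) (a b x l : R) (F : R -> R) :
  a < x < b -> has_deriv_in `[a, b] F x l -> is_derive x 1 F l.
Proof.
move=> /andP[ax xb] Fl; have h : h^-1 *: (F (h *: 1 + x) - F x) @[h --> 0^'] --> l.
  apply/cvgrPdist_lt => e e0; move/cvgrPdist_lt : Fl => /(_ e e0).
  rewrite !near_withinE => /nbhs_ballP[d /= d0 bd]; apply/nbhs_ballP.
  (* This radius keeps the shifted point inside [[a, b]], where the relative quotient is the
     ordinary one. *)
  exists (Num.min d (Num.min (x - a) (b - x))) => /=.
    by rewrite !lt_min d0/= !subr_gt0 ax.
  move=> y; rewrite /ball/= sub0r normrN !lt_min => /andP[yd /andP[ya yb]] y0.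
  have := bd (y + x); rewrite /ball/= opprD addrCA subrr addr0 normrN => /(_ yd).
  rewrite -subr_eq0 addrK => /(_ y0).
  rewrite in_itv/= [y *: 1]mulr1 [_^-1 *: _]mulrC; apply.
  by move: ya yb; rewrite !ltr_norml => /andP[? ?] /andP[? ?]; lra.
apply: DeriveDef; first by apply/cvg_ex; exists l.
exact: cvg_lim h.
Qed.

Lemma has_deriv_in_lipschitz (R : realType) (a b M : R) (F f : R -> R) :
  (forall x, a <= x <= b -> has_deriv_in `[a, b] F x (f x)) ->
  (forall x, a <= x <= b -> `|f x| <= M) ->
  forall x y, a <= x -> x <= y -> y <= b -> `|F y - F x| <= M * (y - x).
Proof.
move=> Ff fM x y ax xy yb.
have [||c cxy ->] := @MVT_segment R F f x y xy.
- move=> z; rewrite in_itv/= => /andP[xz zy].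
  have azb : a < z < b by lra.
  by apply: has_deriv_in_is_derive azb (Ff z _); lra.
- apply/subspace_continuousP => z; rewrite /= in_itv/= => /andP[xz zy].
  have /has_deriv_in_cvg : has_deriv_in `[x, y] F z (f z).
    apply: has_deriv_in_sub (Ff z _); last lra.
    by move=> w /=; rewrite !in_itv/= => ?; lra.
  move=> /cvgrPdist_lt h; apply/cvgrPdist_lt => e e0; move: (h e e0); rewrite !near_withinE.
  apply: filterS => w wxy xyw; have [->|wz] := eqVneq w z; first by rewrite subrr normr0.
  by apply: wxy => //; exact/eqP.
rewrite normrM [X in _ * X]ger0_norm ?subr_ge0// ler_wpM2r ?subr_ge0//.
by move: cxy; rewrite in_itv/= => ?; apply: fM; lra.
Qed.

Lemma has_deriv_in_abs_continuous_on (R : realType) (a b M : R) (F f : R -> R) :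
  (forall x, a <= x <= b -> has_deriv_in `[a, b] F x (f x)) ->
  (forall x, a <= x <= b -> `|f x| <= M) ->
  abs_continuous_on a b F.
Proof.
by move=> Ff fM; apply: lipschitz_abs_continuous_on; exact: has_deriv_in_lipschitz Ff fM.
Qed.

Lemma horner_bounded_on (R : realType) (a b : R) (p : {poly R}) :
  exists M, forall x, a <= x <= b -> `|p.[x]| <= M.
Proof.
have [M pM] := poly_disk_bound p (`|a| + `|b|); exists M => x xab; apply: pM.
have Na : - a <= `|a| by rewrite -normrN ler_norm.
by rewrite ler_norml; have := ler_norm b; have := normr_ge0 a; have := normr_ge0 b; lra.
Qed.

Lemma horner_lipschitz (R : realType) (a b : R) (p : {poly R}) :
  exists M, forall x y, a <= x -> x <= y -> y <= b -> `|p.[y] - p.[x]| <= M * (y - x).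
Proof.
have [M pM] := horner_bounded_on a b p^`(); exists M.
by apply: has_deriv_in_lipschitz pM => x _; exact: has_deriv_in_horner.
Qed.

Lemma horner_abs_continuous_on (R : realType) (a b : R) (p : {poly R}) :
  abs_continuous_on a b (fun x => p.[x]).
Proof. by have [M pM] := horner_lipschitz a b p; exact: lipschitz_abs_continuous_on pM. Qed.

(** * Integration by parts against a polynomial kernel *)

Lemma integrable_abs_continuous_onM (R : realType) (a b : R) (F g : R -> R) :
  a <= b -> abs_continuous_on a b F -> (@lebesgue_measure R).-integrable `[a, b] (EFin \o g) ->
  (@lebesgue_measure R).-integrable `[a, b] (EFin \o (fun x => F x * g x)).
Proof.
move=> ab acF ig; have [M FM] := abs_continuous_on_bounded ab acF.
have /integrableP[/measurable_EFinP mF _] := abs_continuous_on_integrable acF.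
have mab : measurable (`[a, b]%classic : set (measurableTypeR R)) by exact: measurable_itv.
apply: (@integrableMr _ _ _ _ _ mab F (EFin \o g) mF _ ig).
exists M; split; first exact: num_real.
by move=> y My x /=; rewrite in_itv/= => /andP[ax xb]; apply: le_trans (ltW My); exact: FM.
Qed.

(** All [n] integrations by parts are done at once: [Phi] is absolutely continuous and its
    derivative telescopes to the integrand. The last factor [F n] need only be a derivative almost
    everywhere. *)
Lemma poly_integration_by_parts (R : realType) (c d : R) (n : nat) (q : nat -> {poly R})
    (F : nat -> R -> R) :
  c < d -> (forall k, (q k.+1)^`() = q k) ->
  (forall k, (k < n)%N -> abs_continuous_on c d (F k)) ->
  (@lebesgue_measure R).-integrable `[c, d] (EFin \o F n) ->
  (forall k, (k.+1 < n)%N -> forall x, c < x < d -> has_deriv_in `[c, d] (F k) x (F k.+1 x)) ->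
  {ae @lebesgue_measure R, forall x, c < x < d -> has_deriv_in `[c, d] (F n.-1) x (F n x)} ->
  (0 < n)%N ->
  let Phi x := \sum_(0 <= k < n) (-1) ^+ k * (q k.+1).[x] * F k x in
  \int[@lebesgue_measure R]_(x in `[c, d]) ((q 0).[x] * F 0 x - (-1) ^+ n * ((q n).[x] * F n x)) =
  Phi d - Phi c.
Proof.
move=> cd qS acF iFn hF hFn n0 Phi.
have iF k : (k <= n)%N -> (@lebesgue_measure R).-integrable `[c, d] (EFin \o (fun x => (q k).[x] * F k x)).
  move=> kn; apply: integrable_abs_continuous_onM; [exact: ltW|exact: horner_abs_continuous_on|].
  by move: kn; rewrite leq_eqVlt => /predU1P[->//|kn]; apply/abs_continuous_on_integrable/acF.
have mcd : measurable (`[c, d]%classic : set (measurableTypeR R)) by exact: measurable_itv.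
apply: (abs_continuous_on_FTC cd).
- apply: abs_continuous_on_sum => k kn; apply: abs_continuous_onM; [exact: ltW| |exact: acF].
  rewrite (_ : (fun x => _) = (fun x => ((-1) ^+ k *: q k.+1).[x])); first exact: horner_abs_continuous_on.
  by apply/funext => x; rewrite hornerZ.
- have i0 := iF 0 (leq0n n); have in' := iF n (leqnn n).
  have iN := integrableZl mcd ((-1) ^+ n) in'.
  by have := integrableB mcd i0 iN.
apply: ae_imply hFn => x hx xcd.
(* The product rule applied to the terms of [Phi] gives an alternating sum in which only the terms
   at 0 and [n] survive. *)
rewrite (_ : (q 0).[x] * F 0 x - _ = \sum_(0 <= k < n) ((-1) ^+ k * (q k).[x] * F k x
    + (-1) ^+ k * (q k.+1).[x] * F k.+1 x)); last first.
  rewrite -[RHS]opprK -sumrN (@telescope_sumr_eq _ 0 n (fun k => (-1) ^+ k * ((q k).[x] * F k x)))//.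
    by rewrite expr0; ring.
  by move=> k _; rewrite exprS; ring.
apply: has_deriv_in_sum => k kn; apply: has_deriv_inM.
- have -> : (fun y => (-1) ^+ k * (q k.+1).[y]) = (fun y => ((-1) ^+ k *: q k.+1).[y]).
    by apply/funext => y; rewrite hornerZ.
  have -> : (-1) ^+ k * (q k).[x] = ((-1) ^+ k *: q k.+1)^`().[x] by rewrite derivZ qS hornerZ.
  exact: has_deriv_in_horner.
- have [kn1|] := ltnP k.+1 n; first exact: hF.
  rewrite leq_eqVlt ltnNge => /predU1P[E|]; last by rewrite kn.
  by move: (hx xcd); rewrite E.
Qed.

(** * Square-integrable functions on an interval *)

Lemma L2_on_integrable_sqr (R : realType) (a b : R) (g : R -> R) : L2_on a b g ->
  (@lebesgue_measure R).-integrable `[a, b] (EFin \o (fun x => g x ^+ 2)).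
Proof.
move=> /Lfun2_integrable_sqr h.
have mab : measurable (`[a, b]%classic : set (measurableTypeR R)) by exact: measurable_itv.
apply/integrable_mkcond => //; apply: eq_integrable h => // x _.
by rewrite /= !patchE; case: ifP => // _; rewrite expr0n.
Qed.

Lemma L2_on_measurable (R : realType) (a b : R) (g : R -> R) : L2_on a b g ->
  measurable_fun (`[a, b]%classic : set (measurableTypeR R)) g.
Proof.
rewrite /L2_on inE => /andP[]; rewrite inE/= => mg _.
by apply/(measurable_restrictT _ _).2 => //; exact: measurable_itv.
Qed.

(** On a bounded interval [1 + g ^+ 2] is integrable and dominates [|g|]. *)
Lemma L2_on_integrable (R : realType) (a b : R) (g : R -> R) : L2_on a b g ->
  (@lebesgue_measure R).-integrable `[a, b] (EFin \o g).
Proof.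
move=> l2g; have ig2 := L2_on_integrable_sqr l2g.
have mab : measurable (`[a, b]%classic : set (measurableTypeR R)) by exact: measurable_itv.
have i1 : (@lebesgue_measure R).-integrable `[a, b] (EFin \o (fun=> 1 : R)).
  apply: continuous_compact_integrable; first exact: segment_compact.
  by apply: continuous_subspaceT => x; exact: cvg_cst.
apply: le_integrable (integrableD mab i1 ig2) => //.
  by apply/measurable_EFinP; exact: L2_on_measurable.
move=> x _ /=; rewrite lee_fin [leRHS]ger0_norm; last by rewrite addr_ge0// sqr_ge0.
by rewrite -[g x ^+ 2]real_normK ?num_real//; have := sqr_ge0 (`|g x| - 1); have := sqr_ge0 `|g x|; lra.
Qed.

Lemma L2norm_on_sqr (R : realType) (a b : R) (g : R -> R) : L2_on a b g ->
  L2norm_on a b g ^+ 2 = \int[@lebesgue_measure R]_(x in `[a, b]) g x ^+ 2.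
Proof.
move=> l2g; have ig2 := L2_on_integrable_sqr l2g.
have mab : measurable (`[a, b]%classic : set (measurableTypeR R)) by exact: measurable_itv.
have n0 := @Lnorm_ge0 _ _ R (@lebesgue_measure R) 2%:E (EFin \o (g \_ `[a, b]%classic)).
have nfin : 'N[@lebesgue_measure R]_2%:E[EFin \o (g \_ `[a, b]%classic)]%E \is a fin_num.
  rewrite ge0_fin_numE//; move: l2g; rewrite /L2_on inE => /andP[_].
  by rewrite inE.
rewrite /L2norm_on -powR_mulrn ?fine_ge0//.
have := @powR_Lnorm _ _ R (@lebesgue_measure R) (EFin \o (g \_ `[a, b]%classic)) 2.
rewrite -[X in (X `^ _)%E]fineK// => /(_ (lt0r_neq0 (ltr0Sn _ 1))) /=.
move=> /(congr1 fine) /= ->.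
rewrite Rintegral_mkcond; congr fine; apply: eq_integral => x _ /=.
rewrite powR_mulrn// !patchE.
by case: ifP => _; rewrite ?real_normK ?num_real ?normr0 ?expr0n//.
Qed.

Lemma integrable_sqr_L2_on (R : realType) (a b : R) (g : R -> R) :
  measurable_fun (`[a, b]%classic : set (measurableTypeR R)) g ->
  (@lebesgue_measure R).-integrable `[a, b] (EFin \o (fun x => g x ^+ 2)) -> L2_on a b g.
Proof.
move=> mg ig2.
have mab : measurable (`[a, b]%classic : set (measurableTypeR R)) by exact: measurable_itv.
rewrite /L2_on inE; apply/andP; split; rewrite inE/=.
  exact/(measurable_restrictT _ _).1.
rewrite /finite_norm unlock; apply: poweR_lty.
have /integrableP[_] := (integrable_mkcond _ mab).1 ig2; apply: le_lt_trans.
rewrite le_eqVlt; apply/predU1P; left; apply: eq_integral => x _ /=.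
rewrite powR_mulrn// !patchE.
by case: ifP => _; rewrite /= ?normr0 ?expr0n//= real_normK ?num_real// ger0_norm ?sqr_ge0.
Qed.

(** * Regularity of admissible functions *)

Lemma admissible_has_deriv_in (R : realType) (a b : R) (n : nat) (f : R -> R) :
  admissible a b n f ->
  forall k, (k.+1 < n)%N -> forall x, a <= x <= b ->
  has_deriv_in `[a, b] (derive1n_in `[a, b] k f) x (derive1n_in `[a, b] k.+1 f x).
Proof.
move=> [df _ _] k kn x xab; apply: derivable_in_has_deriv; apply: df.
  by rewrite ltn_subRL add1n.
by rewrite in_itv.
Qed.

(** Descending induction from order [n - 1]: an absolutely continuous derivative is bounded, so the
    derivative one order below is Lipschitz by the mean value theorem. *)
Lemma admissible_abs_continuous_on (R : realType) (a b : R) (n : nat) (f : R -> R) :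
  a < b -> admissible a b n f ->
  forall k, (k < n)%N -> abs_continuous_on a b (derive1n_in `[a, b] k f).
Proof.
move=> ab adf k kn; have [_ acf _] := adf.
have -> : k = (n - 1 - (n - 1 - k))%N by lia.
have : (n - 1 - k < n)%N by lia.
elim: (n - 1 - k)%N => [_|j ih jn]; first by rewrite subn0.
have jS : (n - 1 - j = (n - 1 - j.+1).+1)%N by lia.
have [|M fM] := abs_continuous_on_bounded (ltW ab) (ih _); first by lia.
apply: (@has_deriv_in_abs_continuous_on _ _ _ M _ (derive1n_in `[a, b] (n - 1 - j) f)) => x xab.
  by rewrite jS; apply: admissible_has_deriv_in adf _ _ _ _ => //; lia.
by apply: fM; lra.
Qed.

Lemma admissible_ae_has_deriv_in (R : realType) (a b : R) (n : nat) (f : R -> R) :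
  a < b -> (0 < n)%N -> admissible a b n f ->
  {ae @lebesgue_measure R, forall x, a < x < b ->
    has_deriv_in `[a, b] (derive1n_in `[a, b] n.-1 f) x (derive1n_in `[a, b] n f x)}.
Proof.
move=> ab n0 [_ acf _].
have [g [_ _]] := abs_continuous_on_has_deriv_in ab acf; apply: ae_imply => x h xab.
have hx := h xab; rewrite -{2}(prednK n0) /derive1n_in iterS -/(derive1n_in _ _ _) -subn1.
rewrite (has_deriv_in_lim ab _ hx)//.
by rewrite in_itv/=; lra.
Qed.

Lemma Rintegral_itv_split (R : realType) (a m b : R) (f : R -> R) : a <= m -> m <= b ->
  (@lebesgue_measure R).-integrable `[a, b] (EFin \o f) ->
  \int[@lebesgue_measure R]_(x in `[a, b]) f x =
  \int[@lebesgue_measure R]_(x in `[a, m]) f x + \int[@lebesgue_measure R]_(x in `[m, b]) f x.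
Proof.
move=> am mb intf; have := @Rintegral_itvB R f (BLeft a) (BRight b) m intf.
rewrite !bnd_simp => /(_ am mb).
rewrite Rintegral_itv_obnd_cbnd; first by move=> <-; ring.
apply: integrableS intf => //.
by move=> z /=; rewrite !in_itv/= => /andP[mz ->]; rewrite andbT ltW// (le_lt_trans am).
Qed.

Lemma integrable_subitv (R : realType) (a b c d : R) (f : R -> R) : a <= c -> d <= b ->
  (@lebesgue_measure R).-integrable `[a, b] (EFin \o f) ->
  (@lebesgue_measure R).-integrable `[c, d] (EFin \o f).
Proof.
move=> ac db intf; apply: integrableS intf => //.
by move=> z /=; rewrite !in_itv/= => /andP[cz zd]; rewrite (le_trans ac)// (le_trans zd).
Qed.

(** * The polynomial pieces of the kernel, their boundary terms and their integrals *)

(* [appell c s k] is the k-th antiderivative of 1 that takes the value [- s] at [c]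
   when [k = 1] and vanishes there when [k > 1]. *)
Definition appell (R : realType) (c s : R) (k : nat) : {poly R} :=
  (k`!%:R)^-1 *: (('X - c%:P) ^+ k - (s * k%:R) *: ('X - c%:P) ^+ k.-1).

(** The Appell property, which makes these polynomials a valid [q] in [poly_integration_by_parts].
    At [k = 0] the truncated exponent [k.-1] is harmless, its coefficient being zero. *)
Lemma deriv_appell (R : realType) (c s : R) (k : nat) : (appell c s k.+1)^`() = appell c s k.
Proof.
rewrite /appell derivZ derivB derivZ !deriv_exp !derivB derivX derivC subr0 !mul1r.
rewrite -[_ *+ k.+1]scaler_nat -[_ *+ k.+1.-1]scaler_nat !scalerBr !scalerA factS natrM invfM.
have k0 : (k.+1%:R : R) != 0 by rewrite pnatr_eq0.
have f0 : (k`!%:R : R) != 0 by rewrite pnatr_eq0 -lt0n fact_gt0.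
move: (k`!%:R : R) f0 => u u0; move: (k.+1%:R : R) k0 => v v0.
congr (_ *: _ - _ *: _); first by field; rewrite u0 v0.
by rewrite /=; field; rewrite u0 v0.
Qed.

Lemma horner_appell (R : realType) (c s x : R) (k : nat) :
  (appell c s k).[x] = ((x - c) ^+ k - s * k%:R * (x - c) ^+ k.-1) / k`!%:R.
Proof. by rewrite /appell !(hornerE, horner_exp) mulrC. Qed.

Lemma appell0 (R : realType) (c s : R) : appell c s 0 = 1.
Proof. by rewrite /appell fact0 invr1 mulr0 scale0r subr0 scale1r. Qed.

Lemma sum_even (R : realType) (p : nat) (g : nat -> R) :
  \sum_(0 <= k < (2 * p).+1) (1 + (-1) ^+ k) * g k = 2 * \sum_(0 <= i < p.+1) g (2 * i)%N.
Proof.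
elim: p => [|p ih]; first by rewrite !big_nat1 expr0.
rewrite (_ : (2 * p.+1).+1 = (2 * p).+3); last by lia.
rewrite (big_nat_recr p.+1)//= mulrDr -ih (big_nat_recr (2 * p).+2)// (big_nat_recr (2 * p).+1)//=.
have -> : (2 * p).+2 = (2 * p.+1)%N by lia.
by rewrite exprS !exprM sqrrN !expr1n; ring.
Qed.

(** The ends [a] and [b] give the trapezoidal part of the rule. At [m] the two polynomial pieces
    differ by parity, so only derivatives of even order survive. *)
Lemma boundary_terms_quad (R : realType) (a b theta : R) (n : nat) (f : R -> R) :
  odd n ->
  let h := (b - a) / 2 in let m := (a + b) / 2 in
  let F k := derive1n_in `[a, b] k f in
  let Phi c s x := \sum_(0 <= k < n) (-1) ^+ k * (appell c s k.+1).[x] * F k x in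
  (Phi a (theta * h) m - Phi a (theta * h) a) +
  (Phi b (- (theta * h)) b - Phi b (- (theta * h)) m) = quad a b n theta f.
Proof.
move=> on h m F Phi.
(* At its own centre only the [appell] polynomial of degree 1 is nonzero, with value [- s]. *)
have bnd c s : Phi c s c = - s * F 0 c.
  case: n on @Phi => // n on Phi.
  rewrite /Phi big_nat_recl//= big1_seq => [|k _].
    rewrite horner_appell subrr /= factS fact0 muln1 !(expr0, expr1). by field.
  by rewrite horner_appell subrr /= !exprS !(mul0r, mulr0, subrr).
rewrite !bnd.
have -> : Phi a (theta * h) m - - (theta * h) * F 0 a + (- - (theta * h) * F 0 b - Phi b (- (theta * h)) m) =
  (Phi a (theta * h) m - Phi b (- (theta * h)) m) + theta * h * (F 0 a + F 0 b) by ring.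
have n2 : n = (2 * n./2).+1 by have := odd_double_half n; rewrite on; lia.
(* Replacing [h] by [- h] multiplies the value of [appell] of index [k.+1] by [(-1) ^+ k.+1], whence
   the factor [1 + (-1) ^+ k]. *)
have -> : Phi a (theta * h) m - Phi b (- (theta * h)) m = \sum_(0 <= k < n)
   (1 + (-1) ^+ k) * ((1 - theta * k.+1%:R) * h ^+ k.+1 / k.+1`!%:R * F k m).
  rewrite /Phi -sumrB; apply: eq_bigr => k _; rewrite !horner_appell.
  have -> : m - a = h by rewrite /m /h; field.
  have -> : m - b = - h by rewrite /m /h; field.
  rewrite /= [(- h) ^+ k]exprNn [(- h) ^+ k.+1]exprNn !exprS.
  have e1 : (-1 : R) ^+ k * (-1) ^+ k = 1 by rewrite -exprMn mulrNN mulr1 expr1n.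
  move: (k.+1`!%:R^-1 : R) (k.+1%:R : R) => u v.
  transitivity (((-1) ^+ k + (-1) ^+ k * (-1) ^+ k) * ((1 - theta * v) * (h * h ^+ k) * u * F k m)); first by ring.
  by rewrite e1; ring.
rewrite {1}n2 sum_even /quad.
rewrite (_ : ((n - 1) %/ 2).+1 = (n./2).+1); last by lia.
(* Index 0 is the midpoint term. In the others, doubling [h ^+ (2 * i + 1)] gives
   [(b - a) ^+ (2 * i + 1)] over [2 ^+ (2 * i)]. *)
rewrite big_nat_recl// big_add1 -pred_Sn mulrDr.
rewrite (_ : 2 * (\sum_(0 <= i < _) _) = \sum_(0 <= i < n./2)
    (1 - theta * (2 * i.+1 + 1)%:R) * (b - a) ^+ (2 * i.+1 + 1) /
    ((2 * i.+1 + 1)`!%:R * 2 ^+ (2 * i.+1)) * derive1n_in `[a, b] (2 * i.+1) f m); last first.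
  rewrite mulr_sumr; apply: eq_bigr => i _; rewrite !addn1 -/(F _).
  move: (2 * i.+1)%N => j.
  have f0 : (j.+1`!%:R : R) != 0 by rewrite pnatr_eq0 -lt0n fact_gt0.
  have p0 : (2 : R) ^+ j != 0 by rewrite expf_neq0 ?pnatr_eq0.
  rewrite /h exprMn exprVn !exprS.
  move: (j.+1`!%:R : R) f0 ((2 : R) ^+ j) p0 => u u0 v v0.
  by field; rewrite u0 v0.
rewrite muln0 factS fact0 muln1 expr1 /F /= -/m /h.
by field.
Qed.

Lemma Rintegral_deriv_poly (R : realType) (c d : R) (p : {poly R}) : c < d ->
  \int[@lebesgue_measure R]_(x in `[c, d]) (p^`()).[x] = p.[d] - p.[c].
Proof.
move=> cd; apply: (abs_continuous_on_FTC cd (horner_abs_continuous_on c d p)).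
  exact/abs_continuous_on_integrable/horner_abs_continuous_on.
apply: (ae_imply (P := fun=> True)); last exact: aeW.
by move=> x _ _; exact: has_deriv_in_horner.
Qed.

(** The antiderivatives of index [n.+1] vanish at [a] and [b] respectively, and take equal values at
    [m] because [n.+1] is even. *)
Lemma integral_appell (R : realType) (a b theta : R) (n : nat) : a < b -> odd n ->
  let h := (b - a) / 2 in let m := (a + b) / 2 in
  \int[@lebesgue_measure R]_(x in `[a, m]) (appell a (theta * h) n).[x] +
  \int[@lebesgue_measure R]_(x in `[m, b]) (appell b (- (theta * h)) n).[x] = 0.
Proof.
move=> ab on h m; have am : a < m by rewrite /m; lra.
have mb : m < b by rewrite /m; lra.
rewrite -(deriv_appell a) -(deriv_appell b) !Rintegral_deriv_poly// !horner_appell !subrr.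
have -> : m - a = h by rewrite /m /h; field.
have -> : m - b = - h by rewrite /m /h; field.
case: n on => // n on.
have s1 : (-1 : R) ^+ n.+1 = -1 by rewrite -signr_odd on expr1.
have s2 : (-1 : R) ^+ n.+2 = 1 by rewrite exprS s1 mulrNN mulr1.
rewrite /= [(- h) ^+ n.+1]exprNn [(- h) ^+ n.+2]exprNn s1 s2.
by rewrite !exprS !(mul0r, mulr0); ring.
Qed.

(** The antiderivative comes from expanding the square into powers [2 * n], [2 * n - 1] and
    [2 * n - 2] of [x - c] and integrating termwise. *)
Lemma appell_sqr (R : realType) (c s : R) (n : nat) : (0 < n)%N ->
  let p : {poly R} := (n`!%:R ^- 2) *: (((2 * n + 1)%:R^-1 : R) *: ('X - c%:P) ^+ (2 * n + 1)
    - s *: ('X - c%:P) ^+ (2 * n) +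
    (s ^+ 2 * n%:R ^+ 2 / (2 * n - 1)%:R) *: ('X - c%:P) ^+ (2 * n - 1)) in
  forall x, (p^`()).[x] = (appell c s n).[x] ^+ 2.
Proof.
case: n => // n _ p x.
have E1 : (2 * n.+1 + 1 = (2 * n).+3)%N by lia.
have E2 : (2 * n.+1 = (2 * n).+2)%N by lia.
have E3 : (2 * n.+1 - 1 = (2 * n).+1)%N by lia.
have D k : (('X - c%:P) ^+ k.+1)^`() = k.+1%:R *: ('X - c%:P) ^+ k :> {poly R}.
  by rewrite deriv_exp derivB derivX derivC subr0 mul1r /= scaler_nat.
rewrite /p E1 E3 E2; have [k kE] : exists k, (2 * n = k)%N by exists (2 * n)%N.
rewrite kE derivZ derivD derivB !derivZ !D horner_appell -pred_Sn.
rewrite !(hornerZ, hornerD, hornerN, horner_exp, hornerX, hornerC).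
have n0 : (n.+1`!%:R : R) != 0 by rewrite pnatr_eq0 -lt0n fact_gt0.
have k1 : (k.+1%:R : R) != 0 by rewrite pnatr_eq0.
have k3 : (k.+3%:R : R) != 0 by rewrite pnatr_eq0.
have -> : k.+2%:R = 2 * n.+1%:R :> R by rewrite -natrM; congr _%:R; lia.
move: (n.+1`!%:R : R) n0 (k.+1%:R : R) k1 (k.+3%:R : R) k3 => u u0 v v0 w w0.
move: (x - c) => y.
have e0 : y ^+ k = y ^+ n * y ^+ n by rewrite -exprD addnn -mul2n kE.
rewrite [y ^+ k.+2]exprS [y ^+ k.+1]exprS [y ^+ n.+1]exprS e0.
by field; rewrite u0 v0 w0.
Qed.

(** Both halves contribute equally, and [2 * h ^+ (2 * n + 1)] is [(b - a) ^+ (2 * n + 1)] over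
    [2 ^+ (2 * n)]; this is the square of the constant to be proved. *)
Lemma integral_appell_sqr (R : realType) (a b theta : R) (n : nat) : a < b -> odd n ->
  let h := (b - a) / 2 in let m := (a + b) / 2 in
  \int[@lebesgue_measure R]_(x in `[a, m]) (appell a (theta * h) n).[x] ^+ 2 +
  \int[@lebesgue_measure R]_(x in `[m, b]) (appell b (- (theta * h)) n).[x] ^+ 2 =
  (b - a) ^+ (2 * n + 1) / (n`!%:R * 2 ^+ n) ^+ 2 *
  ((theta ^+ 2 * n%:R ^+ 2 * (2 * n%:R + 1) - theta * (4 * n%:R ^+ 2 - 1) + (2 * n%:R - 1))
     / ((2 * n%:R + 1) * (2 * n%:R - 1))).
Proof.
move=> ab on h m; have am : a < m by rewrite /m; lra.
have mb : m < b by rewrite /m; lra.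
have n0 : (0 < n)%N by case: n on.
have A c s := @appell_sqr R c s n n0.
under eq_Rintegral do rewrite -A.
under [X in _ + X]eq_Rintegral do rewrite -A.
rewrite !Rintegral_deriv_poly// !(hornerZ, hornerD, hornerN, horner_exp, hornerX, hornerC).
have -> : m - a = h by rewrite /m /h; field.
have -> : m - b = - h by rewrite /m /h; field.
case: n on n0 {A} => // n on _.
have E1 : (2 * n.+1 + 1 = (2 * n).+3)%N by lia.
have E2 : (2 * n.+1 = (2 * n).+2)%N by lia.
have E3 : (2 * n.+1 - 1 = (2 * n).+1)%N by lia.
rewrite E1 E3 E2; have [k kE] : exists k, (2 * n = k)%N by exists (2 * n)%N.
rewrite kE !subrr.
have z j : (0 : R) ^+ j.+1 = 0 by rewrite exprS mul0r.
have p1 (y : R) : y ^+ k.+1 = y * y ^+ k by rewrite exprS.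
have p2 (y : R) : y ^+ k.+2 = y * (y * y ^+ k) by rewrite exprS p1.
have p3 (y : R) : y ^+ k.+3 = y * (y * (y * y ^+ k)) by rewrite exprS p2.
rewrite !z !mulr0 !p1 !p2 !p3.
have -> : k.+1%:R = 2 * n.+1%:R - 1 :> R.
  by apply/eqP; rewrite eq_sym subr_eq natr1 -natrM; apply/eqP; congr _%:R; lia.
have -> : k.+3%:R = 2 * n.+1%:R + 1 :> R by rewrite -natrM natr1; congr _%:R; lia.
have n0 : (n.+1`!%:R : R) != 0 by rewrite pnatr_eq0 -lt0n fact_gt0.
have N1 : (1 : R) <= n.+1%:R by rewrite ler1n.
have k1 : 2 * (n.+1%:R : R) - 1 != 0.
  by apply: lt0r_neq0; move: (n.+1%:R : R) N1 => v; lra.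
have k3 : 2 * (n.+1%:R : R) + 1 != 0.
  by apply: lt0r_neq0; move: (n.+1%:R : R) N1 => v; lra.
rewrite (_ : (- h) ^+ k = h ^+ k); last by rewrite -kE exprM sqrrN -exprM.
rewrite (_ : (b - a) ^+ k = h ^+ k * 2 ^+ n * 2 ^+ n); last first.
  by rewrite -mulrA -exprD addnn -mul2n kE -exprMn /h divfK ?pnatr_eq0.
have -> : b - a = 2 * h by rewrite /h; field.
rewrite [2 ^+ n.+1]exprS.
have t0 : (2 : R) ^+ n != 0 by rewrite expf_neq0 ?pnatr_eq0.
move: (n.+1`!%:R : R) n0 (n.+1%:R : R) k1 k3 ((2 : R) ^+ n) t0 (h ^+ k) => u u0 v v1 v3 t t0 w.
by field; rewrite u0 v1 v3 t0.
Qed.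

(** * The error of the quadrature rule *)

(** The centre [x0] and the shift [s] stay free so that both halves are instances. Oddness of [n]
    gives the second integral its plus sign. *)
Lemma integral_appell_by_parts (R : realType) (a b c d x0 s : R) (n : nat) (f : R -> R) :
  a < b -> odd n -> admissible a b n f -> a <= c -> c < d -> d <= b ->
  let F k := derive1n_in `[a, b] k f in
  let Phi x := \sum_(0 <= k < n) (-1) ^+ k * (appell x0 s k.+1).[x] * F k x in
  \int[@lebesgue_measure R]_(x in `[c, d]) f x +
  \int[@lebesgue_measure R]_(x in `[c, d]) ((appell x0 s n).[x] * F n x) = Phi d - Phi c.
Proof.
move=> ab on adf ac cd db F Phi.
have n0 : (0 < n)%N by case: n on {adf Phi}.
have acF k : (k < n)%N -> abs_continuous_on c d (F k).
  by move=> kn; apply: abs_continuous_on_sub ac db _; exact: admissible_abs_continuous_on ab adf _ kn.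
have sub : `[c, d] `<=` `[a, b].
  by move=> z /=; rewrite !in_itv/= => /andP[cz zd]; rewrite (le_trans ac)// (le_trans zd).
have iFn : (@lebesgue_measure R).-integrable `[c, d] (EFin \o F n).
  by have [_ _ /L2_on_integrable] := adf; exact: integrable_subitv.
rewrite -(poly_integration_by_parts cd (deriv_appell x0 s) acF iFn _ _ n0); first last.
- apply: ae_imply (admissible_ae_has_deriv_in ab n0 adf) => x h xcd.
  by apply: has_deriv_in_sub sub (h _); lra.
- move=> k kn x xcd; apply: has_deriv_in_sub sub _.
  by apply: admissible_has_deriv_in adf _ kn _ _; lra.
have mcd : measurable (`[c, d]%classic : set (measurableTypeR R)) by exact: measurable_itv.
rewrite -RintegralD//; last 2 first.
- exact: (abs_continuous_on_integrable (acF 0%N n0)).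
- by apply: integrable_abs_continuous_onM => //; [exact: ltW|exact: horner_abs_continuous_on].
apply: eq_Rintegral => x _; rewrite appell0 hornerC mul1r.
by rewrite -signr_odd on expr1 mulN1r opprK.
Qed.

Lemma quad_error (R : realType) (a b theta : R) (n : nat) (f : R -> R) :
  a < b -> odd n -> admissible a b n f ->
  let h := (b - a) / 2 in let m := (a + b) / 2 in
  \int[@lebesgue_measure R]_(x in `[a, b]) f x - quad a b n theta f =
  - (\int[@lebesgue_measure R]_(x in `[a, m]) ((appell a (theta * h) n).[x] * derive1n_in `[a, b] n f x) +
     \int[@lebesgue_measure R]_(x in `[m, b]) ((appell b (- (theta * h)) n).[x] * derive1n_in `[a, b] n f x)).
Proof.
move=> ab on adf h m; have am : a < m by rewrite /m; lra.
have mb : m < b by rewrite /m; lra.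
have n0 : (0 < n)%N by case: n on {adf}.
have intf : (@lebesgue_measure R).-integrable `[a, b] (EFin \o f).
  exact: (abs_continuous_on_integrable (admissible_abs_continuous_on ab adf n0)).
rewrite (Rintegral_itv_split (ltW am) (ltW mb) intf) -boundary_terms_quad//.
rewrite -!integral_appell_by_parts//; [|exact: ltW|exact: ltW].
by rewrite -/h -/m; ring.
Qed.

(** The expanded integral of [(g x - k - t * p.[x]) ^+ 2]. It will be used on each half, where the
    kernel is a polynomial, with [k] the mean of [g] over the whole of [[a, b]]. *)
Lemma integral_sqr_ge0_expand (R : realType) (c d t k : R) (p : {poly R}) (g : R -> R) : c < d ->
  (@lebesgue_measure R).-integrable `[c, d] (EFin \o g) ->
  (@lebesgue_measure R).-integrable `[c, d] (EFin \o (fun x => g x ^+ 2)) ->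
  0 <= \int[@lebesgue_measure R]_(x in `[c, d]) g x ^+ 2
       - 2 * k * \int[@lebesgue_measure R]_(x in `[c, d]) g x + k ^+ 2 * (d - c)
       - 2 * t * \int[@lebesgue_measure R]_(x in `[c, d]) (p.[x] * g x)
       + 2 * t * k * \int[@lebesgue_measure R]_(x in `[c, d]) p.[x]
       + t ^+ 2 * \int[@lebesgue_measure R]_(x in `[c, d]) p.[x] ^+ 2.
Proof.
move=> cd ig ig2.
have mcd : measurable (`[c, d]%classic : set (measurableTypeR R)) by exact: measurable_itv.
have ip q : (@lebesgue_measure R).-integrable `[c, d] (EFin \o (fun x => q.[x])).
  exact/abs_continuous_on_integrable/horner_abs_continuous_on.
have ipg : (@lebesgue_measure R).-integrable `[c, d] (EFin \o (fun x => p.[x] * g x)).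
  by apply: integrable_abs_continuous_onM => //; [exact: ltW|exact: horner_abs_continuous_on].
have ipp : (@lebesgue_measure R).-integrable `[c, d] (EFin \o (fun x => p.[x] ^+ 2)).
  have := ip (p ^+ 2); congr (_.-integrable _ _).
  by apply/funext => x /=; rewrite horner_exp.
have iZ r f : (@lebesgue_measure R).-integrable `[c, d] (EFin \o f) ->
    (@lebesgue_measure R).-integrable `[c, d] (EFin \o (fun x => r * f x)).
  by move=> jf; have := integrableZl mcd r jf.
have iD f1 f2 : (@lebesgue_measure R).-integrable `[c, d] (EFin \o f1) ->
    (@lebesgue_measure R).-integrable `[c, d] (EFin \o f2) ->
    (@lebesgue_measure R).-integrable `[c, d] (EFin \o (fun x => f1 x + f2 x)).
  by move=> j1 j2; have := integrableD mcd j1 j2.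
have i1 : (@lebesgue_measure R).-integrable `[c, d] (EFin \o (fun=> 1 : R)).
  by have := ip 1; congr (_.-integrable _ _); apply/funext => x /=; rewrite hornerC.
have int1 : \int[@lebesgue_measure R]_(x in `[c, d]) 1 = d - c.
  rewrite Rintegral_cst// mul1r; have := @lebesgue_measure_itv R `[c, d]; rewrite /= lte_fin cd.
  by move=> /(congr1 fine) /= ->.
have := @Rintegral_ge0 _ _ R (@lebesgue_measure R) `[c, d]%classic
  (fun x => (g x - k - t * p.[x]) ^+ 2) (fun x _ => sqr_ge0 _).
congr (0 <= _).
transitivity (\int[@lebesgue_measure R]_(x in `[c, d])
   (g x ^+ 2 + ((- 2 * k) * g x + (k ^+ 2 * 1 + ((- 2 * t) * (p.[x] * g x) +
      ((2 * t * k) * p.[x] + t ^+ 2 * p.[x] ^+ 2)))))).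
  by apply: eq_Rintegral => x _; ring.
have j6 := iZ (t ^+ 2) _ ipp.
have j5 := iD _ _ (iZ (2 * t * k) _ (ip p)) j6.
have j4 := iD _ _ (iZ (- 2 * t) _ ipg) j5.
have j3 := iD _ _ (iZ (k ^+ 2) _ i1) j4.
have j2 := iD _ _ (iZ (- 2 * k) _ ig) j3.
rewrite (RintegralD mcd ig2 j2) (RintegralD mcd (iZ _ _ ig) j3) (RintegralD mcd (iZ _ _ i1) j4).
rewrite (RintegralD mcd (iZ _ _ ipg) j5) (RintegralD mcd (iZ _ _ (ip p)) j6).
rewrite (RintegralZl _ mcd ig) (RintegralZl _ mcd i1) (RintegralZl _ mcd ipg).
by rewrite (RintegralZl _ mcd (ip p)) (RintegralZl _ mcd ipp) int1; ring.
Qed.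

(** The Cauchy-Schwarz argument: a quadratic in [t] that is never negative has nonpositive
    discriminant. *)
Lemma discriminant_bound (R : rcfType) (s B N : R) :
  (forall t, 0 <= s - 2 * t * B + t ^+ 2 * N) -> 0 <= N -> `|B| <= Num.sqrt N * Num.sqrt s.
Proof.
move=> h N0; have s0 : 0 <= s by have := h 0; rewrite expr0n /=; lra.
have [N00|Np] : N = 0 \/ 0 < N by move: N0; rewrite le_eqVlt => /predU1P[<-|]; [left|right].
  have [->|B0] := eqVneq B 0; first by rewrite normr0 mulr_ge0// sqrtr_ge0.
  (* With [N = 0] the expression is affine in [t], and at this [t] it equals -1, a contradiction. *)
  have := h ((s + 1) / (2 * B)); rewrite N00.
  have -> : s - 2 * ((s + 1) / (2 * B)) * B + ((s + 1) / (2 * B)) ^+ 2 * 0 = -1 by field.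
  lra.
rewrite -sqrtrM// -sqrtr_sqr ler_wsqrtr//.
(* The minimiser of the quadratic. *)
have := h (B / N).
have -> : s - 2 * (B / N) * B + (B / N) ^+ 2 * N = (N * s - B ^+ 2) / N by field; rewrite gt_eqF.
by rewrite pmulr_lge0 ?invr_gt0// subr_ge0.
Qed.

Lemma sqrt_kernel_constant (R : realType) (r E u : R) (n : nat) : 0 <= r -> 0 <= u ->
  Num.sqrt (r ^+ (2 * n + 1) / u ^+ 2 * E) = r `^ (n%:R + 1 / 2) / u * Num.sqrt E.
Proof.
move=> r0 u0; have p0 : 0 <= r `^ (n%:R + 1 / 2) / u by rewrite divr_ge0// powR_ge0.
rewrite -[X in _ = X * _]ger0_norm// -sqrtr_sqr -sqrtrM ?sqr_ge0//; congr (Num.sqrt (_ * _)).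
rewrite exprMn exprVn; congr (_ / _).
rewrite -!powR_mulrn ?powR_ge0// -powRrM; congr (_ `^ _).
by rewrite natrD natrM; field.
Qed.

Lemma sigma_L2_on (R : realType) (a b : R) (g : R -> R) : L2_on a b g ->
  sigma a b g = \int[@lebesgue_measure R]_(x in `[a, b]) g x ^+ 2 -
    (b - a)^-1 * (\int[@lebesgue_measure R]_(x in `[a, b]) g x) ^+ 2.
Proof. by move=> l2g; rewrite /sigma L2norm_on_sqr. Qed.

(** Subtracting from [f^(n)] its mean and [t] times the kernel, then integrating the square, gives
    [sigma - 2 * t * B + t ^+ 2 * N], to which [discriminant_bound] applies. *)
Lemma quad_error_bound (R : realType) (a b theta : R) (n : nat) (f : R -> R) :
  a < b -> odd n -> admissible a b n f ->
  `| \int[@lebesgue_measure R]_(x in `[a, b]) f x - quad a b n theta f | <=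
  Num.sqrt ((b - a) ^+ (2 * n + 1) / (n`!%:R * 2 ^+ n) ^+ 2 *
    ((theta ^+ 2 * n%:R ^+ 2 * (2 * n%:R + 1) - theta * (4 * n%:R ^+ 2 - 1) + (2 * n%:R - 1))
     / ((2 * n%:R + 1) * (2 * n%:R - 1)))) *
  Num.sqrt (sigma a b (derive1n_in `[a, b] n f)).
Proof.
move=> ab on adf; rewrite quad_error// normrN -integral_appell_sqr//.
set h := (b - a) / 2; set m := (a + b) / 2; set g := derive1n_in _ _ _.
have am : a < m by rewrite /m; lra.
have mb : m < b by rewrite /m; lra.
have [_ _ l2g] := adf; have ig := L2_on_integrable l2g; have ig2 := L2_on_integrable_sqr l2g.
set BL := Rintegral _ _ _; set BR := Rintegral _ _ _; set NL := Rintegral _ _ _.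
set NR := Rintegral _ _ _.
apply: discriminant_bound; last first.
  by apply: addr_ge0; apply: Rintegral_ge0 => x _; exact: sqr_ge0.
move=> t; rewrite sigma_L2_on// (Rintegral_itv_split (ltW am) (ltW mb) ig2).
set k := (b - a)^-1 * \int[@lebesgue_measure R]_(x in `[a, b]) g x.
have := integral_sqr_ge0_expand t k (appell a (theta * h) n) am
  (integrable_subitv (lexx a) (ltW mb) ig) (integrable_subitv (lexx a) (ltW mb) ig2).
have := integral_sqr_ge0_expand t k (appell b (- (theta * h)) n) mb
  (integrable_subitv (ltW am) (lexx b) ig) (integrable_subitv (ltW am) (lexx b) ig2).
have := integral_appell theta ab on; rewrite -/h -/m /= -/BL -/BR -/NL -/NR.
set IL := Rintegral _ _ _; set IR := Rintegral _ _ _ => IE.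
rewrite /k (Rintegral_itv_split (ltW am) (ltW mb) ig).
set GR2 := Rintegral _ _ _; set GL := Rintegral _ _ _; set GR := Rintegral _ _ _.
set GL2 := Rintegral _ _ _ => hR hL.
(* The kernel has mean zero, so the cross terms between it and the constant [k] cancel. *)
have IRE : IR = - IL by apply/eqP; rewrite -addr_eq0 addrC IE.
move: (addr_ge0 hL hR); rewrite IRE; congr (0 <= _).
by clearbody BL BR NL NR IL GR2 GL GR GL2 m; field; rewrite subr_eq0 gt_eqF.
Qed.

(** * Extremal functions *)

(** Vanishing to order [n] at [c] is what lets two such antiderivatives be glued at [c] with
    matching derivatives up to order [n - 1]. *)
Lemma poly_antiderivative (R : numFieldType) (c : R) (n : nat) (p : {poly R}) :
  exists q : {poly R}, q^`(n) = p /\ forall j, (j < n)%N -> (q^`(j)).[c] = 0.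
Proof.
elim: n p => [|n ih] p; first by exists p.
have [r [rn rc]] := ih p.
(* At [i = 0] the coefficient is a division by zero, hence 0; the constant term is corrected
   afterwards. *)
pose q0 := \poly_(i < (size r).+1) (r`_i.-1 / i%:R).
have q0r : q0^`() = r.
  apply/polyP => i; rewrite coef_deriv coef_poly ltnS.
  have [ir|ri] := ltnP i (size r).
    by rewrite -[_ *+ i.+1]mulr_natr divfK ?pnatr_eq0.
  by rewrite mul0rn nth_default.
exists (q0 - (q0.[c])%:P); have dq : (q0 - (q0.[c])%:P)^`() = r by rewrite derivB derivC subr0.
split; first by rewrite derivSn dq.
move=> [_|j jn]; first by rewrite derivn0 !hornerE subrr.
by rewrite derivSn dq rc.
Qed.

Definition glue (R : realType) (m : R) (p q : {poly R}) (x : R) : R :=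
  if x <= m then p.[x] else q.[x].

Lemma glue_le (R : realType) (m x : R) (p q : {poly R}) : x <= m -> glue m p q x = p.[x].
Proof. by rewrite /glue => ->. Qed.

Lemma glue_gt (R : realType) (m x : R) (p q : {poly R}) : m < x -> glue m p q x = q.[x].
Proof. by rewrite /glue ltNge => /negbTE ->. Qed.

(** Off [m] the glued function is locally a single polynomial. Requiring equal slopes only when
    [x = m] allows the derivative of order [n] to jump at [m]. *)
Lemma has_deriv_in_glue (R : realType) (A : set R) (m x : R) (p q : {poly R}) :
  p.[m] = q.[m] -> (x = m -> (p^`()).[m] = (q^`()).[m]) ->
  has_deriv_in A (glue m p q) x (glue m p^`() q^`() x).
Proof.
move=> pq dpq.
have hp := @has_deriv_in_horner R A p x; have hq := @has_deriv_in_horner R A q x.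
have [xm|mx|xm] := ltgtP x m.
- rewrite glue_le ?ltW//; apply: cvg_trans hp; apply: near_eq_cvg.
  rewrite !near_withinE; have : \forall y \near x, y < m by exact: lt_nbhsl.
  by apply: filterS => y ym _ _; rewrite !glue_le ?ltW.
- rewrite glue_gt//; apply: cvg_trans hq; apply: near_eq_cvg.
  rewrite !near_withinE; have : \forall y \near x, m < y by exact: lt_nbhsr.
  by apply: filterS => y ym _ _; rewrite !glue_gt.
- subst x; rewrite glue_le//; apply/cvgrPdist_lt => e e0.
  move/cvgrPdist_lt : hp => /(_ e e0); move/cvgrPdist_lt : hq => /(_ e e0).
  rewrite !near_withinE; apply: filterS2 => y hq hp ym Ay.
  have [yle|yge] := leP y m; first by rewrite !glue_le//; exact: hp.
  rewrite glue_gt// glue_le// pq dpq//; exact: hq.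
Qed.

Lemma glue_abs_continuous_on (R : realType) (a b m : R) (p q : {poly R}) :
  p.[m] = q.[m] -> a <= m -> m <= b ->
  abs_continuous_on a b (glue m p q).
Proof.
move=> pq am mb; have [M pM] := horner_lipschitz a b p; have [N qN] := horner_lipschitz a b q.
apply: (@lipschitz_abs_continuous_on _ _ _ (`|M| + `|N|)) => x y ax xy yb.
have LM := ler_norm M; have LN := ler_norm N; have M0 := normr_ge0 M; have N0 := normr_ge0 N.
have [ym|my] := leP y m.
  rewrite !glue_le//; last exact: le_trans ym.
  apply: le_trans (pM _ _ ax xy yb) _; apply: ler_wpM2r; first by rewrite subr_ge0.
  by lra.
rewrite glue_gt//; have [xm|mx] := leP x m; last first.
  rewrite glue_gt//; apply: le_trans (qN _ _ ax xy yb) _; apply: ler_wpM2r; first by rewrite subr_ge0.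
  by lra.
rewrite glue_le//.
(* When [x] and [y] lie on different sides, the increment is routed through the common value at
   [m]. *)
have -> : q.[y] - p.[x] = (q.[y] - q.[m]) + (p.[m] - p.[x]) by rewrite pq; ring.
apply: le_trans (ler_normD _ _) _.
have h1 := qN _ _ am (ltW my) yb; have h2 := pM _ _ ax xm mb.
have h3 : N * (y - m) <= `|N| * (y - x)
  by apply: le_trans (_ : `|N| * (y - m) <= _); [apply: ler_wpM2r|apply: ler_wpM2l]; lra.
have h4 : M * (m - x) <= `|M| * (y - x)
  by apply: le_trans (_ : `|M| * (m - x) <= _); [apply: ler_wpM2r|apply: ler_wpM2l]; lra.
by rewrite mulrDl; lra.
Qed.

(** Nothing is assumed about [g m], which may be a junk derivative; the singleton gets its own
    indicator and its own term in the bound. *)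
Lemma L2_on_piecewise_poly (R : realType) (a b m : R) (p q : {poly R}) (g : R -> R) :
  (forall x, a <= x <= b -> x < m -> g x = p.[x]) ->
  (forall x, a <= x <= b -> m < x -> g x = q.[x]) ->
  L2_on a b g.
Proof.
move=> gp gq.
have mab : measurable (`[a, b]%classic : set (measurableTypeR R)) by exact: measurable_itv.
have mp r : measurable_fun (`[a, b]%classic : set (measurableTypeR R)) (fun x => r.[x] : R).
  have /integrableP[/measurable_EFinP] := abs_continuous_on_integrable (horner_abs_continuous_on a b r).
  by [].
have mg : measurable_fun (`[a, b]%classic : set (measurableTypeR R)) g.
  apply: (@eq_measurable_fun _ _ _ _ _
    (fun x => (\1_`]-oo, m[ x * p.[x] + \1_`]m, +oo[ x * q.[x] + \1_[set m] x * g m : R))).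
    move=> x; rewrite inE/= in_itv/= => xab; rewrite !indicE.
    have -> : (x \in `]-oo, m[%classic) = (x < m).
      by apply/idP/idP; rewrite inE/= in_itv.
    have -> : (x \in `]m, +oo[%classic) = (m < x).
      by apply/idP/idP; rewrite inE/= in_itv/= andbT.
    have -> : (x \in [set m]) = (x == m) by apply/idP/eqP; rewrite inE.
    have [xm|mx|->] := ltgtP x m.
    - by rewrite (gp x)//=; ring.
    - by rewrite (gq x)//=; ring.
    - by rewrite /=; ring.
  have mI A : measurable A -> measurable_fun (`[a, b]%classic : set (measurableTypeR R)) (\1_A : R -> R).
    by move=> mA; exact: measurable_indic.
  apply: measurable_funD; [apply: measurable_funD|]; apply: measurable_funM.
  - by apply: mI; exact: measurable_itv.
  - exact: mp.
  - by apply: mI; exact: measurable_itv.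
  - exact: mp.
  - by apply: mI; exact: measurable_set1.
  - exact: measurable_cst.
have [M pM] := horner_bounded_on a b p; have [N qN] := horner_bounded_on a b q.
apply: integrable_sqr_L2_on => //; apply: measurable_bounded_integrable => //.
- have /= -> := @lebesgue_measure_itv R `[a, b]; rewrite lte_fin.
  by case: ifP => _; rewrite -?EFinB ltry.
- exact: measurable_funX.
exists ((`|M| + `|N| + `|g m|) ^+ 2); split; first exact: num_real.
move=> K hK x; rewrite /= in_itv/= => xab; apply: le_trans (ltW hK).
rewrite ger0_norm ?sqr_ge0// -[leLHS]real_normK ?num_real//.
rewrite ler_sqr ?nnegrE ?addr_ge0//.
have [xm|mx|->] := ltgtP x m.
- by rewrite gp//; have := pM x xab; have := ler_norm M; have := normr_ge0 N; have := normr_ge0 (g m); lra.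
- by rewrite gq//; have := qN x xab; have := ler_norm N; have := normr_ge0 M; have := normr_ge0 (g m); lra.
- by have := normr_ge0 M; have := normr_ge0 N; lra.
Qed.

(** The function glues [n]-fold antiderivatives of [p] and [q] that vanish to order [n] at [m]. *)
Lemma exists_admissible_piecewise_poly (R : realType) (a b m : R) (n : nat) (p q : {poly R}) :
  a < m -> m < b -> (0 < n)%N ->
  exists f : R -> R, [/\ admissible a b n f,
    forall x, a <= x <= b -> x < m -> derive1n_in `[a, b] n f x = p.[x] &
    forall x, a <= x <= b -> m < x -> derive1n_in `[a, b] n f x = q.[x]].
Proof.
move=> am mb n0; have ab : a < b by exact: lt_trans mb.
have [P [Pn Pm]] := poly_antiderivative m n p; have [Q [Qn Qm]] := poly_antiderivative m n q.
pose D k := glue m P^`(k) Q^`(k).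
have hD k x : (k < n)%N -> (x = m -> (k.+1 < n)%N) -> has_deriv_in `[a, b] (D k) x (D k.+1 x).
  move=> kn xm; rewrite /D !derivnS; apply: has_deriv_in_glue; first by rewrite Pm// Qm.
  by move=> /xm kn1; rewrite -!derivnS Pm// Qm.
exists (D 0%N); set F := fun k => derive1n_in `[a, b] k (D 0%N).
have FD k x : (k < n)%N -> a <= x <= b -> F k x = D k x.
  elim: k x => [//|k ih] x kn xab; rewrite /F /derive1n_in iterS.
  apply: has_deriv_in_lim => //.
  apply: (has_deriv_in_eq (F := D k)) => //.
  - by move=> y; rewrite inE/= => yab; apply/esym/ih => //; exact: ltnW.
  - by apply: hD => //; exact: ltnW.
have hF k x : (k < n)%N -> (x = m -> (k.+1 < n)%N) -> a <= x <= b ->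
    has_deriv_in `[a, b] (F k) x (D k.+1 x).
  move=> kn xm xab; apply: (has_deriv_in_eq (F := D k)) => //; last exact: hD.
  by move=> y; rewrite inE/= => yab; rewrite FD.
have FnD x : a <= x <= b -> x <> m -> F n x = D n x.
  move=> xab xm; rewrite /F -(prednK n0) /derive1n_in iterS.
  by apply: has_deriv_in_lim => //; apply: hF => //; rewrite prednK.
have Fp x : a <= x <= b -> x < m -> F n x = p.[x].
  by move=> xab xm; rewrite FnD// /D ?glue_le ?ltW// ?Pn//; apply/eqP; rewrite lt_eqF.
have Fq x : a <= x <= b -> m < x -> F n x = q.[x].
  by move=> xab xm; rewrite FnD// /D ?glue_gt// ?Qn//; apply/eqP; rewrite gt_eqF.
split => //; split.
- move=> k kn x xab; apply/cvg_ex; exists (D k.+1 x); apply: hF => //; lia.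
- have n1 : (n - 1 < n)%N by lia.
  have := @glue_abs_continuous_on R a b m P^`(n - 1) Q^`(n - 1).
  rewrite Pm// Qm// => /(_ erefl (ltW am) (ltW mb)) acD.
  move=> e /acD[d d0 h]; exists d => // k u v uv tuv sd.
  rewrite (eq_bigr (fun i => `|D (n - 1)%N (v i) - D (n - 1)%N (u i)|)); first exact: h.
  move=> i _; have [au [uvi vb]] := uv i.
  by rewrite -/(F (n - 1)%N) !FD// ?au ?vb ?(le_trans au uvi) ?(le_trans uvi vb).
- exact: L2_on_piecewise_poly Fp Fq.
Qed.

(** With [f^(n)] equal to the kernel off [m], the error is minus the squared norm of the kernel, and
    [sigma] is that squared norm because the kernel has mean zero. *)
Lemma exists_extremal (R : realType) (a b theta : R) (n : nat) : a < b -> odd n ->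
  let N := (b - a) ^+ (2 * n + 1) / (n`!%:R * 2 ^+ n) ^+ 2 *
    ((theta ^+ 2 * n%:R ^+ 2 * (2 * n%:R + 1) - theta * (4 * n%:R ^+ 2 - 1) + (2 * n%:R - 1))
     / ((2 * n%:R + 1) * (2 * n%:R - 1))) in
  exists f : R -> R, [/\ admissible a b n f, 0 <= N,
    \int[@lebesgue_measure R]_(x in `[a, b]) f x - quad a b n theta f = - N &
    sigma a b (derive1n_in `[a, b] n f) = N].
Proof.
move=> ab on N; pose h := (b - a) / 2; pose m := (a + b) / 2.
have am : a < m by rewrite /m; lra.
have mb : m < b by rewrite /m; lra.
have n0 : (0 < n)%N by case: n on {N}.
pose p := appell a (theta * h) n; pose q := appell b (- (theta * h)) n.
have [f [adf fp fq]] := @exists_admissible_piecewise_poly R a b m n p q am mb n0.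
have [_ _ l2g] := adf; have ig := L2_on_integrable l2g; have ig2 := L2_on_integrable_sqr l2g.
set g := derive1n_in `[a, b] n f in fp fq l2g ig ig2 *.
(* Comparison on the open interval suffices, which avoids the unknown value of [g] at [m]. *)
have eqI c d (F G : R -> R) : (@lebesgue_measure R).-integrable `[c, d] (EFin \o F) ->
    (@lebesgue_measure R).-integrable `[c, d] (EFin \o G) ->
    (forall x, c < x < d -> F x = G x) ->
    \int[@lebesgue_measure R]_(x in `[c, d]) F x = \int[@lebesgue_measure R]_(x in `[c, d]) G x.
  move=> iF iG FG; rewrite !Rintegral_itvcc_itvoo//; apply: eq_Rintegral => x.
  by rewrite inE/= in_itv/= => /FG.
have ip c d r : (@lebesgue_measure R).-integrable `[c, d] (EFin \o (fun x => r.[x])).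
  exact/abs_continuous_on_integrable/horner_abs_continuous_on.
have ip2 c d r : (@lebesgue_measure R).-integrable `[c, d] (EFin \o (fun x => r.[x] ^+ 2)).
  have := ip c d (r ^+ 2); congr (_.-integrable _ _).
  by apply/funext => x /=; rewrite horner_exp.
have ipg c d r : c <= d -> (@lebesgue_measure R).-integrable `[c, d] (EFin \o g) ->
    (@lebesgue_measure R).-integrable `[c, d] (EFin \o (fun x => r.[x] * g x)).
  by move=> cd; apply: integrable_abs_continuous_onM => //; exact: horner_abs_continuous_on.
have igL := integrable_subitv (lexx a) (ltW mb) ig.
have igR := integrable_subitv (ltW am) (lexx b) ig.
have ig2L := integrable_subitv (lexx a) (ltW mb) ig2.
have ig2R := integrable_subitv (ltW am) (lexx b) ig2.
have NE : \int[@lebesgue_measure R]_(x in `[a, m]) p.[x] ^+ 2 +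
    \int[@lebesgue_measure R]_(x in `[m, b]) q.[x] ^+ 2 = N.
  exact: integral_appell_sqr.
have gL x : a < x < m -> g x = p.[x] by move=> xam; apply: fp; lra.
have gR x : m < x < b -> g x = q.[x] by move=> xmb; apply: fq; lra.
exists f; split => //.
- by rewrite -NE; apply: addr_ge0; apply: Rintegral_ge0 => x _; exact: sqr_ge0.
- rewrite quad_error// -/h -/m -/p -/q -/g -NE; congr (- (_ + _)).
  + by apply: eqI => //; [apply: ipg => //; exact: ltW|move=> x /gL ->].
  + by apply: eqI => //; [apply: ipg => //; exact: ltW|move=> x /gR ->].
- rewrite sigma_L2_on// (Rintegral_itv_split (ltW am) (ltW mb) ig2).
  rewrite (Rintegral_itv_split (ltW am) (ltW mb) ig).
  rewrite (eqI a m g (fun x => p.[x])) ?(eqI m b g (fun x => q.[x]))//.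
  rewrite integral_appell// expr0n/= mulr0 subr0 -NE; congr (_ + _).
  + by apply: eqI => // x /gL ->.
  + by apply: eqI => // x /gR ->.
Qed.

(** * The inequality and its sharpness *)

Theorem theorem8 (R : realType) (a b : R) (n : nat)
    (hab : a < b) (hn1 : (1 <= n)%N) (hn : odd n) :
  (forall f : R -> R, admissible a b n f ->
   forall theta : R, 0 <= theta <= 1 ->
     `| \int[@lebesgue_measure R]_(x in `[a, b]) f x - quad a b n theta f |
     <= (b - a) `^ (n%:R + 1 / 2) / (n`!%:R * 2 ^+ n)
        * Num.sqrt ((theta ^+ 2 * n%:R ^+ 2 * (2 * n%:R + 1)
                     - theta * (4 * n%:R ^+ 2 - 1) + (2 * n%:R - 1))
                    / ((2 * n%:R + 1) * (2 * n%:R - 1)))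
        * Num.sqrt (sigma a b (derive1n_in `[a, b]%classic n f)))
  /\
  (forall theta : R, 0 <= theta <= 1 ->
   forall C : R, 0 < C ->
     (forall f : R -> R, admissible a b n f ->
        `| \int[@lebesgue_measure R]_(x in `[a, b]) f x - quad a b n theta f |
        <= C * (b - a) `^ (n%:R + 1 / 2)
           * Num.sqrt (sigma a b (derive1n_in `[a, b]%classic n f))) ->
     1 / (n`!%:R * 2 ^+ n)
     * Num.sqrt ((theta ^+ 2 * n%:R ^+ 2 * (2 * n%:R + 1)
                  - theta * (4 * n%:R ^+ 2 - 1) + (2 * n%:R - 1))
                 / ((2 * n%:R + 1) * (2 * n%:R - 1)))
     <= C).
Proof.
have ab0 : 0 <= b - a by rewrite subr_ge0 ltW.
have u0 : (0 : R) <= n`!%:R * 2 ^+ n by rewrite mulr_ge0 ?ler0n ?exprn_ge0.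
have sqrtN E := sqrt_kernel_constant E n ab0 u0.
split=> [f adf theta _|theta _ C C0 hC].
  by rewrite -sqrtN; exact: quad_error_bound.
have [f [adf N0 IE sE]] := exists_extremal theta hab hn.
(* For the extremal function the error is [N = Num.sqrt N ^+ 2], so one factor [Num.sqrt N] can be
   cancelled against the root of [sigma]. *)
have := hC f adf; rewrite IE sE normrN ger0_norm// -{1}(sqr_sqrtr N0).
rewrite expr2 => h.
have p0 : 0 < (b - a) `^ (n%:R + 1 / 2) by apply: powR_gt0; rewrite subr_gt0.
move: h; rewrite sqrtN; set E := Num.sqrt _; set w := (b - a) `^ _ in p0 *.
set u := n`!%:R * _ in u0 *.
have [->|E0] := eqVneq E 0; first by move=> _; rewrite mulr0 ltW.
have Ep : 0 < E by rewrite lt_neqAle eq_sym E0 sqrtr_ge0.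
have up : 0 < u by rewrite mulr_gt0 ?ltr0n ?fact_gt0 ?exprn_gt0.
rewrite ler_pM2r; last by rewrite mulr_gt0 ?divr_gt0.
have -> : w / u * E = (1 / u * E) * w by ring.
by rewrite ler_pM2r.
Qed.
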